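(* Let $\epsilon,\gamma>0$ be absolute constants, and suppose that $n,d,p$ with $p=1/2$ satisfy $1/2\ge p\ge n^{-1+\epsilon}$ and $d\ge n^\gamma$. Let $H$ be a connected graph (a subgraph of $K_n$). Then there exists an absolute constant $C$ depending only on $\epsilon,\gamma$ such that for $\mathbf G\sim\mathsf{RGG}(n,\mathbb S^{d-1},\frac12)$, $$\Big|\mathbb E\Big[\prod_{(ji)\in E(H)}(\mathbf G_{ji}-1/2)\Big]\Big|\le(1/2)^{|E(H)|}\times\Big(\frac{C\times|V(H)|\times|E(H)|\times(\log d)^{3/2}}{\sqrt d}\Big)^{\mathsf{SOEI}(H)}.$$
   Context: $\mathsf{RGG}(n,\mathbb S^{d-1},p)$: draw $V_1,\dots,V_n$ i.i.d. uniform on the unit sphere $\mathbb S^{d-1}\subset\mathbb R^d$; $i\neq j$ are adjacent iff $\langle V_i,V_j\rangle\ge\tau^p_d$, where $\Pr[\langle V_i,V_j\rangle\ge\tau^p_d]=p$ (so $\tau_d^{1/2}=0$). $\mathbf G_{ji}\in\{0,1\}$ is the indicator of the edge between $i$ and $j$. Strong ordered independence number. Let $H$ be a connected graph on $k$ vertices and $\pi$ a bijective labelling of its vertices by $\{1,\dots,k\}$; identify vertices with labels and write an edge between $u$ and $v$ as $(uv)$ when $u>v$. For $F\subseteq E(H)$ and a vertex $v$, let $F^{\pi}_{\ge v}$ be the set of edges of $F$ with both endpoints at least $v$, and let $F^\pi_{\ge v,\ni u}$ be the connected component of $F^\pi_{\ge v}$ containing $u$. An edge $(uv)\in E(H)\setminus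 F$ (with $u>v$) is strongly covered by $F$ if $v$ has a neighbour in $H$, other than $u$, belonging to $V(F^\pi_{\ge v,\ni u})$. Let $\overline{\partial}^{\,\pi}_HF$ be the set of edges strongly covered by $F$. $\mathsf{SOEI}_\pi(H)$ is the minimal cardinality of $F\subseteq E(H)$ with $F\cup\overline{\partial}^{\,\pi}_HF=E(H)$, and $\mathsf{SOEI}(H)=\max_\pi\mathsf{SOEI}_\pi(H)$. *)

(* Defs.v *)
From HB Require Import structures.
From mathcomp Require Import all_boot.

Set Implicit Arguments.
Unset Strict Implicit.
Unset Printing Implicit Defensive.

(* A finite simple graph whose vertices are drawn from the ambient type T;
   edges are 2-element sets of vertices. For T = 'I_n these are exactly the
   subgraphs of the complete graph K_n. *)
Record graph (T : finType) := Graph {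
  vertices : {set T};
  edges : {set {set T}};
  edgesP : forall e, e \in edges -> #|e| = 2 /\ e \subset vertices
}.

Section SOEI.
Variable T : finType.
Implicit Types (H : graph T) (F : {set {set T}}) (u v w : T).

Definition adj F u v : bool := [set u; v] \in F.

Definition connected_graph H : Prop :=
  vertices H != set0 /\
  {in vertices H &, forall u v, connect (adj (edges H)) u v}.

(* The labels 1, ..., k are represented by 'I_k = {0, ..., k - 1}: only their
   order matters. Values of pi outside of [vertices H] are irrelevant. *)
Definition labelling H (pi : {ffun T -> 'I_#|vertices H|}) : bool :=
  dinjectiveb pi (vertices H) && (pi @: vertices H == [set: 'I_#|vertices H|]).

Section FixedLabelling.
Variables (H : graph T) (pi : {ffun T -> 'I_#|vertices H|}).

Definition edges_ge F v : {set {set T}} :=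
  [set e in F | [forall w in e, pi v <= pi w]].

(* If u lies on no edge of [edges_ge F v], this is [set u]; the convention does
   not matter below, where u itself is never an admissible witness. *)
Definition component_ge F v u : {set T} :=
  [set w | connect (adj (edges_ge F v)) u w].

Definition strongly_covers F u v : bool :=
  [exists w, [&& adj (edges H) v w, w != u & w \in component_ge F v u]].

Definition strong_boundary F : {set {set T}} :=
  [set e in edges H :\: F |
    [exists u, exists v,
      [&& e == [set u; v], pi v < pi u & strongly_covers F u v]]].

Definition strongly_covering F : bool :=
  (F \subset edges H) && (F :|: strong_boundary F == edges H).

(* [edges H] is itself strongly covering, so the minimum is attained. *)
Definition SOEI_label : nat :=
  #|[arg min_(F < edges H | strongly_covering F) #|F|]|.

End FixedLabelling.

Definition SOEI H : nat :=
  \max_(pi : {ffun T -> 'I_#|vertices H|} | labelling pi) SOEI_label pi.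

End SOEI.

From mathcomp Require Import all_order all_algebra.
From mathcomp Require Import all_classical all_reals all_analysis.

Import Order.TTheory GRing.Theory Num.Theory.
Local Open Scope classical_set_scope.
Local Open Scope ring_scope.

Section RandomGeometricGraph.
Variable R : realType.

(* R^d is [d.-tuple R], which carries the product (Borel) sigma-algebra. *)
Definition dotp d (x y : d.-tuple R) : R := \sum_(i < d) tnth x i * tnth y i.

Definition sphere d : set (d.-tuple R) := [set x | dotp x x = 1].

Definition mulmx_tuple d (Q : 'M[R]_d) (x : d.-tuple R) : d.-tuple R :=
  [tuple \sum_(j < d) Q i j * tnth x j | i < d].

(* The uniform law on the sphere: the (unique) Borel probability measure
   carried by the sphere and invariant under the orthogonal group. *)
Definition uniform_on_sphere d (mu : probability (d.-tuple R) R) : Prop :=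
  mu (@sphere d) = 1%E /\
  forall Q : 'M[R]_d, Q *m Q^T = 1%:M ->
  forall A : set (d.-tuple R), measurable A ->
    mu (mulmx_tuple Q @^-1` A) = mu A.

Section Sample.
Variables (disp : measure_display) (Omega : measurableType disp).
Variables (P : probability Omega R) (n d : nat).
Variable V : 'I_n -> {RV P >-> d.-tuple R}.

(* Subfamilies are obtained by taking [A i = setT]. *)
Definition mutually_independent : Prop :=
  forall A : 'I_n -> set (d.-tuple R), (forall i, measurable (A i)) ->
    P [set w | forall i, A i (V i w)] = (\prod_(i < n) P (V i @^-1` A i))%E.

(* [is_RGG p tau]: V is an i.i.d. uniform sample of the sphere and tau is a
   threshold [tau_d^p] giving each edge probability p. *)
Definition is_RGG (p tau : R) : Prop :=
  [/\ mutually_independent,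
      forall i, uniform_on_sphere (distribution P (V i)) &
      forall i j, i != j -> P [set w | tau <= dotp (V i w) (V j w)] = p%:E].

Definition RGG_edge (tau : R) (w : Omega) (j i : 'I_n) : bool :=
  (j != i) && (tau <= dotp (V j w) (V i w)).

End Sample.

End RandomGeometricGraph.

(* Main.v *)
(** Conditioning on the vectors in the order of a labelling attaining [SOEI H],
    let [z_uv], [v <= u], be the coordinates of the [u]-th vector in the
    Gram-Schmidt basis of the sequence.  For [u > v] the inner product of the
    [u]-th and [v]-th vectors is [z_uv * z_vv] plus a sum over [l < v] of
    [z_ul * z_vl]; call the edge [(uv)] fragile when Cauchy-Schwarz does not
    show that [z_uv * z_vv] dominates.  Fragility only depends on the squares of
    the coordinates, and the joint law is invariant when [z_wv] changes sign for
    all [w] in a set of vertices above [v]: this is a reflection of each [w]-th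
    vector.  If the set [F] of fragile edges does not strongly cover an edge
    [(uv)] outside [F], take for the [w]'s the component of [u] in [F_{>=v}]:
    then exactly one sign, that of [(uv)], changes, and the contribution of [F]
    to the expectation vanishes.  Hence the expectation is at most
    [(1/2)^|E|] times the probability that at least [SOEI H] edges are fragile.

    With [q] of order [k log d / d] and [k = |V(H)|], up to an event of
    probability [d^(- c k)] every fragile edge has [|z_uv| <= 2 q], and given
    the previous vectors the coordinates of a uniform vector satisfy such
    constraints on a set of [a] coordinates with probability at most
    [(24 q sqrt d)^a].  As [SOEI H <= k], a union bound over the sets of
    [SOEI H] edges concludes.  Both estimates on a uniform vector come from
    the identity [E(psi'(x_i) x_j^2 f) = E(psi(x_i) x_i f)], for [f] independent
    of [x_i] and [x_j], which only uses invariance under reflections. *)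

Require Import Defs.
From HB Require Import structures.
From mathcomp Require Import all_boot all_order all_algebra.

Set Implicit Arguments.
Unset Strict Implicit.
Unset Printing Implicit Defensive.

(** * Strongly covering edge sets *)

(** Why the reflected set is a component of [F_{>=v}] and not [u] alone: the sign of a fragile edge
    is out of control as soon as exactly one of its ends is reflected, so no fragile edge above [v]
    may leave the set. A non-fragile edge with lower end above [v] may leave it, its sign being
    decided by a coordinate other than the [v]-th, and an edge with lower end below [v] does not see
    the [v]-th coordinate at all. There remain the edges at [v], so [u] must be the only neighbour
    of [v] in the set, and this is the failure of strong covering. The inequality [SOEI <= k] makes
    two scales agree: the exceptional event costs a power of [1 / sqrt d] with exponent of order
    [k], while the target is a base above [1 / sqrt d] to the power [SOEI]. When the base is at
    least 1 the claim is trivial; otherwise [sqrt d] exceeds a large multiple of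
    [k |E| (ln d)^(3/2)], and every smallness condition follows from that. *)

Section GraphLabelling.
Variables (T : finType) (H : graph T) (pi : {ffun T -> 'I_#|vertices H|}).
Hypothesis piH : labelling pi.
Implicit Types (F A : {set {set T}}) (u v w : T) (e : {set T}).

Lemma pi_inj : {in vertices H &, injective pi}.
Proof. by case/andP: piH => /dinjectiveP. Qed.

Lemma adjC A u v : adj A u v = adj A v u.
Proof. by rewrite /adj setUC. Qed.

Lemma adj_connectC A : connect_sym (adj A).
Proof.
suff h u w : connect (adj A) u w -> connect (adj A) w u by move=> u w; apply/idP/idP; exact: h.
move=> /connectP[p + ->]; elim/last_ind: p => [//|p y IH].
rewrite rcons_path last_rcons => /andP[/IH h a].
by apply: connect_trans h; apply: connect1; rewrite adjC.
Qed.

Lemma connect_mem A u w : connect (adj A) u w ->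
  w = u \/ exists w', adj A w' w && connect (adj A) u w'.
Proof.
move=> /connectP[p + ->]; elim/last_ind: p => [|p y IH]; first by left.
rewrite rcons_path last_rcons => /andP[pp a]; right; exists (last u p).
by rewrite a; apply/connectP; exists p.
Qed.

Lemma adj_vertices F u v : F \subset edges H -> adj F u v ->
  u \in vertices H /\ v \in vertices H.
Proof.
move=> FE uv; have [_ /subsetP sub] := edgesP (subsetP FE _ uv).
by split; apply: sub; rewrite !inE eqxx ?orbT.
Qed.

Lemma edge_ends e : e \in edges H -> exists uv : T * T,
  (e == [set uv.1; uv.2]) && (pi uv.2 < pi uv.1)%N.
Proof.
move=> eE; have [/eqP/cards2P[x [y [xy ee]]] sub] := edgesP eE; rewrite ee in sub *.
have [xV yV] : x \in vertices H /\ y \in vertices H.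
  by split; apply: (subsetP sub); rewrite !inE eqxx ?orbT.
have : pi x != pi y by apply: contraNneq xy => /pi_inj ->.
rewrite -val_eqE; case: ltngtP => // h _; [exists (y, x)|exists (x, y)] => /=.
  by rewrite setUC eqxx.
by rewrite eqxx.
Qed.

(** Edges are unordered pairs; the labelling orients them, larger label first. On an edge the
    default [z] is never reached. *)
Definition ends (z : T) e : T * T :=
  odflt (z, z) [pick uv : T * T | (e == [set uv.1; uv.2]) && (pi uv.2 < pi uv.1)%N].

Lemma endsP z e : e \in edges H ->
  e = [set (ends z e).1; (ends z e).2] /\ (pi (ends z e).2 < pi (ends z e).1)%N.
Proof.
move=> eE; rewrite /ends; case: pickP => [uv /andP[/eqP]//|h].
by have [uv] := edge_ends eE; rewrite h.
Qed.

Lemma ends_vertices z e : e \in edges H ->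
  (ends z e).1 \in vertices H /\ (ends z e).2 \in vertices H.
Proof.
move=> eE; have [ee _] := endsP z eE; apply: (adj_vertices (subxx _)).
by rewrite /adj -ee.
Qed.

(** Strict variant of [edges_ge]: no edge at [v] itself survives. *)
Definition above F v : {set {set T}} := [set e in F | [forall w in e, pi v < pi w]%N].

Lemma adj_above F v a b : adj (above F v) a b = [&& adj F a b, pi v < pi a & pi v < pi b]%N.
Proof.
rewrite /adj inE; case: (_ \in F) => //=; apply/forall_inP/andP => [h|[ha hb] w].
  by split; apply: h; rewrite !inE eqxx ?orbT.
by rewrite !inE => /orP[/eqP->|/eqP->].
Qed.

Lemma adj_edges_ge F v a b :
  adj (edges_ge pi F v) a b = [&& adj F a b, pi v <= pi a & pi v <= pi b]%N.
Proof.
rewrite /adj inE; case: (_ \in F) => //=; apply/forall_inP/andP => [h|[ha hb] w].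
  by split; apply: h; rewrite !inE eqxx ?orbT.
by rewrite !inE => /orP[/eqP->|/eqP->].
Qed.

(** Otherwise the edge [uv] could be dropped. The path from [u] to [u'] above [v], followed by the
    edge [u'v], replaces it in every [edges_ge] that contains it, so components do not shrink; and
    [uv] itself becomes strongly covered, with witness [u']. *)
Lemma minimal_cover_forest F u u' v : strongly_covering pi F ->
  (forall F', strongly_covering pi F' -> #|F| <= #|F'|)%N ->
  adj F u v -> adj F u' v -> (pi v < pi u)%N -> (pi v < pi u')%N ->
  connect (adj (above F v)) u u' -> u = u'.
Proof.
move=> /andP[FE /eqP Fcov] Fmin uv u'v vu vu' con; apply/eqP/negPn/negP => uu'.
pose F' := F :\ [set u; v].
suff /Fmin : strongly_covering pi F'.
  by rewrite (cardsD1 [set u; v] F) (_ : _ \in F) // add1n ltnn.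
have F'F : F' \subset F by exact: subsetDl.
have aboveF' b : (pi b <= pi v)%N -> subrel (adj (above F v)) (adj (edges_ge pi F' b)).
  move=> bv x y; rewrite adj_above adj_edges_ge => /and3P[xy vx vy].
  rewrite !(leq_trans bv) ?(ltnW vx) ?(ltnW vy)// andbT /adj !inE (xy : _ \in F) !andbT.
  apply: contraTneq vy => /setP/(_ v); rewrite !inE eqxx orbT => /orP[/eqP vx'|/eqP <-].
    by move: vx; rewrite -vx' ltnn.
  by rewrite ltnn.
have u'vF' : adj F' u' v.
  rewrite /adj !inE (u'v : _ \in F) ?andbT; apply: contraNneq uu' => /setP/(_ u').
  rewrite !inE eqxx /= => /esym/orP[/eqP->//|/eqP u'v'].
  by move: vu'; rewrite u'v' ltnn.
(* Only a step along [uv] needs the detour, and such a step forces the label of [b] to be at most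
   that of [v]. *)
have conF' b a w : connect (adj (edges_ge pi F b)) a w ->
    connect (adj (edges_ge pi F' b)) a w.
  apply: connect_sub => x y; rewrite adj_edges_ge => /and3P[xy bx bY].
  have [xyuv|xyuv] := eqVneq [set x; y] [set u; v]; last first.
    by apply: connect1; rewrite adj_edges_ge bx bY !andbT /adj !inE xyuv.
  have main : (pi b <= pi v)%N -> connect (adj (edges_ge pi F' b)) u v.
    move=> bv; apply: (@connect_trans _ _ u').
      exact: (connect_sub (fun x y h => connect1 (aboveF' b bv x y h)) con).
    by apply: connect1; rewrite adj_edges_ge u'vF' bv (leq_trans bv (ltnW vu')).
  have ux : u \in [set x; y] by rewrite xyuv !inE eqxx.
  have vx : v \in [set x; y] by rewrite xyuv !inE eqxx orbT.
  have uv' : u != v by apply: contraTneq vu => ->; rewrite ltnn.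
  move: ux vx; rewrite !inE => /orP[/eqP ux|/eqP uy] /orP[/eqP vx|/eqP vy].
  - by rewrite ux vx eqxx in uv'.
  - by rewrite -ux -vy main// vy.
  - by rewrite adj_connectC -uy -vx main// vx.
  - by rewrite uy vy eqxx in uv'.
apply/andP; split; first exact: (subset_trans F'F).
rewrite eqEsubset; apply/andP; split.
  rewrite subUset (subset_trans F'F FE)/=.
  by apply/subsetP => e; rewrite inE => /andP[/setDP[]].
apply/subsetP => e eE; rewrite inE.
have [//|eF'/=] := boolP (e \in F'); rewrite inE inE eF' eE /=.
have [euv|euv] := eqVneq e [set u; v].
  apply/existsP; exists u; apply/existsP; exists v; rewrite euv eqxx vu /=.
  have vu'E : adj (edges H) v u' by rewrite adjC; exact: (subsetP FE _ u'v).
  apply/existsP; exists u'; rewrite eq_sym uu' vu'E /=.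
  rewrite inE; exact: (connect_sub (fun x y h => connect1 (aboveF' v (leqnn _) x y h)) con).
have eF : e \notin F by apply: contra eF'; rewrite !inE euv.
move: eE; rewrite -Fcov inE (negPf eF) inE => /andP[_ /existsP[a /existsP[b]]].
move=> /and3P[eab ba /existsP[w /and3P[bw wa wc]]].
apply/existsP; exists a; apply/existsP; exists b; rewrite eab ba /=.
apply/existsP; exists w; rewrite bw wa /=.
by move: wc; rewrite !inE; exact: conF'.
Qed.

Lemma strongly_covering_edges : strongly_covering pi (edges H).
Proof.
rewrite /strongly_covering subxx /=; apply/eqP/setUidPl/subsetP => e.
by rewrite !inE => /andP[/andP[/negP]].
Qed.

Lemma SOEI_label_min F : strongly_covering pi F -> (SOEI_label pi <= #|F|)%N.
Proof.
move=> cF; rewrite /SOEI_label.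
by case: arg_minnP => [|F0 _ h]; [exact: strongly_covering_edges|exact: h].
Qed.

Lemma connect_above_mem F u v w : F \subset edges H -> u \in vertices H ->
  (pi v < pi u)%N -> connect (adj (above F v)) u w ->
  (w \in vertices H) && (pi v < pi w)%N.
Proof.
move=> FE uV vu /connect_mem[->|[w' /andP[]]]; first by rewrite uV vu.
rewrite adj_above => /and3P[w'w _ ->] _; rewrite andbT.
by have [] := adj_vertices FE w'w.
Qed.

(* Each edge [(uv)] of a minimal covering set is sent to the least vertex of
   the component of [u] above [v]; since [v] lies below that component, the
   edge destroys this least vertex, which makes the map injective. *)
Lemma SOEI_label_le : (SOEI_label pi <= #|vertices H|)%N.
Proof.
rewrite /SOEI_label; case: arg_minnP => [|F Fc Fmin]; first exact: strongly_covering_edges.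
have FE : F \subset edges H by case/andP: Fc.
have [->|[e0 e0F]] := set_0Vmem F; first by rewrite cards0.
have [[z _] _] := edge_ends (subsetP FE _ e0F).
pose root u v := [arg min_(w < u | connect (adj (above F v)) u w) pi w : nat]%N.
have rootP u v : connect (adj (above F v)) u (root u v) /\
    forall w, connect (adj (above F v)) u w -> (pi (root u v) <= pi w)%N.
  by rewrite /root; case: arg_minnP => [|w ? ?]; [exact: connect0|].
pose f e := pi (root (ends z e).1 (ends z e).2).
rewrite -[X in (_ <= X)%N]card_ord -(card_in_imset (f := f)); first exact: max_card.
suff key e e' : e \in F -> e' \in F -> f e = f e' ->
    (pi (ends z e').2 <= pi (ends z e).2)%N -> e = e'.
  move=> e e' eF e'F ff; have [le|/ltnW le] := leqP (pi (ends z e').2) (pi (ends z e).2).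
    exact: key.
  by apply/esym; exact: key.
move=> eF e'F; rewrite /f.
move: (endsP z (subsetP FE _ eF)) (endsP z (subsetP FE _ e'F)).
case: (ends z e) (ends z e') => [u v] [u' v'] [/= ee vu] [/= ee' vu'] ff le.
have uvF : adj F u v by rewrite /adj -ee.
have uvF' : adj F u' v' by rewrite /adj -ee'.
have [uV vV] := adj_vertices FE uvF; have [uV' vV'] := adj_vertices FE uvF'.
have [con mn] := rootP u v; have [con' mn'] := rootP u' v'.
have /andP[rV vr] := connect_above_mem FE uV vu con.
have /andP[rV' vr'] := connect_above_mem FE uV' vu' con'.
have rr : root u v = root u' v' by exact: pi_inj.
(* Same lower end: both upper ends reach the common root above [v], and [minimal_cover_forest]
   identifies them. *)
move: le; rewrite leq_eqVlt => /predU1P[/val_inj/pi_inj vv|lt].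
  have {}vv : v' = v by exact: vv.
  rewrite ee ee' vv; congr [set _; _].
  apply: (minimal_cover_forest Fc Fmin uvF _ vu); rewrite -?vv//.
  rewrite vv; apply: (connect_trans con); rewrite adj_connectC rr -vv.
  exact: con'.
have sub : subrel (adj (above F v)) (adj (above F v')).
  move=> a b; rewrite !adj_above => /and3P[-> va vb].
  by rewrite !(ltn_trans lt).
(* With [v'] strictly below [v], the edge [uv] joins [v] to the component whose least vertex is the
   root; but the root lies above [v]. *)
have : (pi (root u' v') <= pi v)%N.
  apply: mn'; apply: (connect_trans con'); rewrite -rr adj_connectC.
  apply: (@connect_trans _ _ u); last first.
    exact: (connect_sub (fun x y h => connect1 (sub x y h)) con).
  by apply: connect1; rewrite adj_above adjC uvF lt (ltn_trans lt).
by rewrite -rr leqNgt vr.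
Qed.

(** A neighbour of [v] in the component other than [u] would cover the edge. The component avoids
    [v] for the same reason: a path of [F] reaching [v] would arrive through such a neighbour, as
    [uv] is not in [F]. *)
Lemma uncovered_edge F : F \subset edges H -> ~~ strongly_covering pi F ->
  exists u v, [/\ adj (edges H) u v, ~~ adj F u v, (pi v < pi u)%N &
    let C := component_ge pi F v u in
    [/\ u \in C, {in C, forall w, pi v < pi w}%N,
        {in C, forall w, adj (edges H) w v -> w = u} &
        forall a b, adj F a b -> (pi v < pi a)%N -> (pi v < pi b)%N ->
          (a \in C) = (b \in C)]].
Proof.
move=> FE; rewrite /strongly_covering FE /= eqEsubset negb_and.
have -> : F :|: strong_boundary pi F \subset edges H.
  rewrite subUset FE /=; apply/subsetP => e; rewrite inE => /andP[].
  by rewrite inE => /andP[].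
move=> /subsetPn[e eE]; rewrite inE negb_or => /andP[eF].
rewrite inE inE eE eF /= => nb.
have [[u v] /= /andP[/eqP ee vu]] := edge_ends eE.
have uvE : adj (edges H) u v by rewrite /adj -ee.
have [uV vV] := adj_vertices (subxx _) uvE.
have uncov w : adj (edges H) v w -> w != u -> w \notin component_ge pi F v u.
  move=> vw wu; apply: contra nb => wC; apply/existsP; exists u; apply/existsP; exists v.
  by rewrite ee eqxx vu; apply/existsP; exists w; rewrite vw wu.
have nF : ~~ adj F u v by rewrite /adj -ee.
exists u, v; split=> //= ; split.
- by rewrite inE connect0.
- move=> w; rewrite inE => cw.
  have /andP[wV vw] : (w \in vertices H) && (pi v <= pi w)%N.
    have [->|[w' /andP[]]] := connect_mem cw; first by rewrite uV ltnW.
    rewrite adj_edges_ge => /and3P[w'w _ ->] _; rewrite andbT.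
    by have [] := adj_vertices FE w'w.
  rewrite ltn_neqAle vw andbT; apply/negP => /eqP/val_inj/pi_inj vw'.
  have {vw'} wv : v = w by exact: vw'.
  rewrite -wv in cw; have [vu'|[w' /andP[]]] := connect_mem cw.
    by move: vu; rewrite vu' ltnn.
  rewrite adj_edges_ge => /and3P[w'v _ _] cw'.
  have [w'u|w'u] := eqVneq w' u; first by rewrite -w'u w'v in nF.
  have /uncov/(_ w'u) : adj (edges H) v w' by rewrite adjC; exact: (subsetP FE _ w'v).
  by rewrite inE cw'.
- move=> w wC wv; apply/eqP/negPn/negP => wu.
  by have := uncov w; rewrite adjC wv wu wC => /(_ isT isT).
- move=> a b ab va vb; rewrite !inE.
  have ab' : adj (edges_ge pi F v) a b by rewrite adj_edges_ge ab (ltnW va) (ltnW vb).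
  by apply: same_connect_r; [exact: adj_connectC|exact: connect1].
Qed.

End GraphLabelling.

From mathcomp Require Import all_classical all_reals all_analysis.
From mathcomp Require Import measurable_realfun ring lra zify.

Import Order.TTheory GRing.Theory Num.Theory.
Import numFieldNormedType.Exports.
Local Open Scope classical_set_scope.
Local Open Scope ring_scope.

(** * Means of bounded measurable functions *)

Section BoundedMean.
Context {R : realType} {disp : measure_display} {T : measurableType disp}.
Implicit Types (f g : T -> R) (A : set T).

(** Every integrand below is bounded and measurable: a class stable under sums and products and
    integrable for any probability, so linearity of [mean] needs no separate integrability
    argument. *)
Definition bmf f := measurable_fun setT f /\ exists M : R, forall x, `|f x| <= M.

Lemma eq_bmf f g : f =1 g -> bmf f -> bmf g.
Proof. by move=> /funext ->. Qed.

Lemma bmf_cst (c : R) : bmf (fun=> c).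
Proof. by split; [exact: measurable_cst|exists `|c|]. Qed.

Lemma bmfD f g : bmf f -> bmf g -> bmf (fun x => f x + g x).
Proof.
move=> [mf [M fM]] [mg [N gN]]; split; first exact: measurable_funD.
by exists (M + N) => x; apply: (le_trans (ler_normD _ _)); apply: lerD.
Qed.

Lemma bmfM f g : bmf f -> bmf g -> bmf (fun x => f x * g x).
Proof.
move=> [mf [M fM]] [mg [N gN]]; split; first exact: measurable_funM.
by exists (M * N) => x; rewrite normrM; apply: ler_pM.
Qed.

Lemma bmfN f : bmf f -> bmf (fun x => - f x).
Proof.
move=> [mf [M fM]]; split; first exact: measurableT_comp.
by exists M => x; rewrite normrN.
Qed.

Lemma bmfB f g : bmf f -> bmf g -> bmf (fun x => f x - g x).
Proof. by move=> bf bg; apply: bmfD => //; exact: bmfN. Qed.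

Lemma bmfZ (c : R) f : bmf f -> bmf (fun x => c * f x).
Proof. by move=> bf; apply: bmfM => //; exact: bmf_cst. Qed.

Lemma bmf_sum I (r : seq I) (p : pred I) (F : I -> T -> R) :
  (forall i, p i -> bmf (F i)) -> bmf (fun x => \sum_(i <- r | p i) F i x).
Proof.
move=> bF; elim: r => [|i r IH].
  by apply: eq_bmf (bmf_cst _) => x; rewrite big_nil.
have [pi|pi] := boolP (p i); last first.
  by apply: eq_bmf IH => x; rewrite big_cons (negPf pi).
by apply: eq_bmf (bmfD (bF _ pi) IH) => x; rewrite big_cons pi.
Qed.

Lemma bmf_prod I (r : seq I) (p : pred I) (F : I -> T -> R) :
  (forall i, p i -> bmf (F i)) -> bmf (fun x => \prod_(i <- r | p i) F i x).
Proof.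
move=> bF; elim: r => [|i r IH].
  by apply: eq_bmf (bmf_cst _) => x; rewrite big_nil.
have [pi|pi] := boolP (p i); last first.
  by apply: eq_bmf IH => x; rewrite big_cons (negPf pi).
by apply: eq_bmf (bmfM (bF _ pi) IH) => x; rewrite big_cons pi.
Qed.

Lemma bmf_ind A : measurable A -> bmf (\1_A : T -> R).
Proof.
move=> mA; split; first exact: measurable_indic.
exists 1 => x; rewrite indicE.
by case: (x \in A); rewrite ?normr1 ?normr0.
Qed.

Variable P : probability T R.

Definition mean f : R := \int[P]_x f x.

Lemma bmf_integrable f : bmf f -> P.-integrable setT (EFin \o f).
Proof.
move=> [mf [M fM]]; apply: measurable_bounded_integrable => //.
  by rewrite (le_lt_trans (probability_le1 _ _)) ?ltry.
exists M; split; first exact: num_real.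
by move=> x Mx y _ /=; apply: (le_trans (fM y)); exact: ltW.
Qed.

Lemma mean_integral f : bmf f -> (\int[P]_x (f x)%:E)%E = (mean f)%:E.
Proof.
move=> bf; rewrite /mean /Rintegral fineK //.
exact: integrable_fin_num (bmf_integrable bf).
Qed.

Lemma mean_cst (c : R) : mean (fun=> c) = c.
Proof. by rewrite /mean Rintegral_cst//= probability_setT/= mulr1. Qed.

Lemma eq_mean f g : f =1 g -> mean f = mean g.
Proof. by move=> fg; congr mean; exact: funext. Qed.

Lemma meanD f g : bmf f -> bmf g -> mean (fun x => f x + g x) = mean f + mean g.
Proof. by move=> bf bg; rewrite /mean RintegralD//; exact: bmf_integrable. Qed.

Lemma meanB f g : bmf f -> bmf g -> mean (fun x => f x - g x) = mean f - mean g.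
Proof. by move=> bf bg; rewrite /mean RintegralB//; exact: bmf_integrable. Qed.

Lemma meanZ (c : R) f : bmf f -> mean (fun x => c * f x) = c * mean f.
Proof. by move=> bf; rewrite /mean RintegralZl//; exact: bmf_integrable. Qed.

Lemma mean_sum I (r : seq I) (p : pred I) (F : I -> T -> R) :
  (forall i, p i -> bmf (F i)) ->
  mean (fun x => \sum_(i <- r | p i) F i x) = \sum_(i <- r | p i) mean (F i).
Proof.
move=> bF; elim: r => [|i r IH].
  by rewrite big_nil -[RHS](mean_cst 0); apply: eq_mean => x; rewrite big_nil.
rewrite big_cons -IH; have [pi|pi] := boolP (p i); last first.
  by apply: eq_mean => x; rewrite big_cons (negPf pi).
rewrite -meanD//; [|exact: bF|exact: bmf_sum].
by apply: eq_mean => x; rewrite big_cons pi.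
Qed.

Lemma le_mean f g : bmf f -> bmf g -> (forall x, f x <= g x) -> mean f <= mean g.
Proof.
by move=> bf bg fg; apply: le_Rintegral => //; exact: bmf_integrable.
Qed.

Lemma mean_ge0 f : (forall x, 0 <= f x) -> 0 <= mean f.
Proof. by move=> f0; apply: Rintegral_ge0. Qed.

Lemma mean_norm_le f g : bmf f -> bmf g -> (forall x, `|f x| <= g x) ->
  `|mean f| <= mean g.
Proof.
move=> bf bg fg; rewrite ler_norml -mulN1r -meanZ// !le_mean//; last first.
- by move=> x; have := fg x; rewrite ler_norml mulN1r => /andP[].
- exact: bmfZ.
- by move=> x; have := fg x; rewrite ler_norml => /andP[].
Qed.

Lemma mean_ind A : measurable A -> (mean \1_A)%:E = P A.
Proof.
move=> mA; rewrite -mean_integral; last exact: bmf_ind.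
by rewrite integral_indic// setIT.
Qed.

End BoundedMean.

Lemma bmf_comp {R : realType} {d1 d2 : measure_display}
    {T1 : measurableType d1} {T2 : measurableType d2} (phi : T1 -> T2)
    (f : T2 -> R) :
  measurable_fun setT phi -> bmf f -> bmf (f \o phi).
Proof.
move=> mphi [mf [M fM]]; split; first exact: measurableT_comp.
by exists M => x; exact: fM.
Qed.

Lemma mean_transfer {R : realType} {d1 d2 : measure_display}
    {T1 : measurableType d1} {T2 : measurableType d2} (P : probability T1 R)
    (Q : probability T2 R) (phi : T1 -> T2) (f : T2 -> R) :
  measurable_fun setT phi ->
  (forall A, measurable A -> P (phi @^-1` A) = Q A) ->
  bmf f -> mean P (f \o phi) = mean Q f.
Proof.
move=> mphi PQ bf; apply: EFin_inj.
rewrite -!mean_integral//; last exact: bmf_comp.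
transitivity (\int[pushforward P phi]_x (f x)%:E)%E; last first.
  by apply: eq_measure_integral => A mA _; exact: PQ.
rewrite (@integral_pushforward _ _ _ _ _ phi)//.
- by apply/measurable_EFinP; case: bf.
- by rewrite preimage_setT; exact: (bmf_integrable _ (bmf_comp mphi bf)).
Qed.

(** * Reflections and the uniform law on the sphere *)

Section Dot.
Context {R : realType} {d : nat}.
Implicit Types (a b c w : 'I_d -> R) (x y : d.-tuple R) (k : R).

Definition dot a b : R := \sum_(i < d) a i * b i.

Lemma dotC a b : dot a b = dot b a.
Proof. by apply: eq_bigr => i _; rewrite mulrC. Qed.

Lemma dotBl a b c : dot (fun i => a i - b i) c = dot a c - dot b c.
Proof. by rewrite /dot -sumrB; apply: eq_bigr => i _; rewrite mulrBl. Qed.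

Lemma dotBr a b c : dot c (fun i => a i - b i) = dot c a - dot c b.
Proof. by rewrite dotC dotBl !(dotC c). Qed.

Lemma dotZl k a b : dot (fun i => k * a i) b = k * dot a b.
Proof. by rewrite /dot mulr_sumr; apply: eq_bigr => i _; rewrite mulrA. Qed.

Lemma dotZr k a b : dot a (fun i => k * b i) = k * dot a b.
Proof. by rewrite dotC dotZl dotC. Qed.

Lemma dot_ge0 a : 0 <= dot a a.
Proof. by apply: sumr_ge0 => i _; rewrite -expr2 sqr_ge0. Qed.

Lemma dot_eq0 a : dot a a = 0 -> forall i, a i = 0.
Proof.
move=> /eqP; rewrite psumr_eq0; last by move=> i _; rewrite -expr2 sqr_ge0.
by move=> /allP a0 i; have := a0 i (mem_index_enum _); rewrite mulf_eq0 orbb => /eqP.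
Qed.

Definition refl w x : d.-tuple R :=
  [tuple tnth x i - 2 * (dot (tnth x) w / dot w w) * w i | i < d].

(** Matrix form of [refl], the form in which invariance of the uniform law is given. For [w = 0]
    division by 0 makes both the identity. *)
Definition householder w : 'M[R]_d :=
  \matrix_(i, j) ((i == j)%:R - 2 * (w i * w j / dot w w)).

Lemma sum_delta (i : 'I_d) a : \sum_(j < d) (i == j)%:R * a j = a i.
Proof.
rewrite (bigD1 i)//= eqxx mul1r big1 ?addr0// => j ji.
by rewrite eq_sym (negPf ji) mul0r.
Qed.

Lemma householder_refl w x : mulmx_tuple (householder w) x = refl w x.
Proof.
apply: eq_from_tnth => i; rewrite !tnth_mktuple.
transitivity (\sum_j ((i == j)%:R * tnth x j -
    2 * (w i / dot w w) * (tnth x j * w j))).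
  by apply: eq_bigr => j _; rewrite mxE; ring.
rewrite sumrB sum_delta -mulr_sumr -/(dot _ _); congr (_ - _); ring.
Qed.

Lemma householder_row w i a :
  \sum_(j < d) householder w i j * a j = a i - 2 * (dot a w / dot w w) * w i.
Proof.
transitivity (\sum_j ((i == j)%:R * a j - 2 * (w i / dot w w) * (a j * w j))).
  by apply: eq_bigr => j _; rewrite mxE; ring.
rewrite sumrB sum_delta -mulr_sumr -/(dot _ _); congr (_ - _); ring.
Qed.

Lemma householder_orth w : householder w *m (householder w)^T = 1%:M.
Proof.
apply/matrixP => i j; rewrite !mxE.
under eq_bigr do rewrite [X in _ * X]mxE.
rewrite householder_row !mxE.
have -> : dot (fun l => householder w j l) w =
    w j - 2 * (dot w w / dot w w) * w j by rewrite -householder_row.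
have [w0|w0] := eqVneq (dot w w) 0.
  by rewrite w0 invr0 !(mulr0, mul0r) !subr0 eq_sym.
by rewrite divff// eq_sym; field.
Qed.

Lemma measurable_refl w : measurable_fun setT (refl w).
Proof.
apply/measurable_fun_tnthP => i /=.
rewrite (_ : _ \o _ = fun x => tnth x i - 2 * (dot (tnth x) w / dot w w) * w i);
  last by apply/funext => x /=; rewrite tnth_mktuple.
apply: measurable_funB; first exact: measurable_tnth.
apply: measurable_funM => //; apply: measurable_funM => //.
apply: measurable_funM => //; apply: measurable_sum => j.
by apply: measurable_funM => //; exact: measurable_tnth.
Qed.

Lemma dot_refl w x a :
  dot (tnth (refl w x)) a =
  dot (tnth x) a - 2 * (dot (tnth x) w / dot w w) * dot w a.
Proof.
rewrite /dot.
under eq_bigr do rewrite tnth_mktuple mulrBl -[X in _ - X]mulrA.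
by rewrite sumrB -mulr_sumr.
Qed.

Lemma dot_refl2 w x y :
  dot (tnth (refl w x)) (tnth (refl w y)) = dot (tnth x) (tnth y).
Proof.
rewrite dot_refl (dotC (tnth x)) (dotC w (tnth _)) !dot_refl (dotC _ (tnth x)).
have [w0|w0] := eqVneq (dot w w) 0.
  by rewrite w0 invr0 !(mulr0, mul0r) !subr0.
by rewrite (dotC w (tnth x)); field.
Qed.

End Dot.

Section Uniform.
Context {R : realType} {d : nat}.
Variable mu : probability (d.-tuple R) R.
Hypothesis mu_unif : uniform_on_sphere mu.

Lemma mean_orth (Q : 'M[R]_d) (f : d.-tuple R -> R) :
  Q *m Q^T = 1%:M -> measurable_fun setT (mulmx_tuple Q) -> bmf f ->
  mean mu (f \o mulmx_tuple Q) = mean mu f.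
Proof.
case: mu_unif => _ inv QQ mQ bf.
by apply: mean_transfer => // A mA; exact: inv.
Qed.

Lemma measurable_mulmx_tuple (Q : 'M[R]_d) :
  measurable_fun setT (mulmx_tuple Q).
Proof.
apply/measurable_fun_tnthP => i /=.
rewrite (_ : _ \o _ = fun x => \sum_j Q i j * tnth x j);
  last by apply/funext => x /=; rewrite tnth_mktuple.
apply: measurable_sum => j.
by apply: measurable_funM => //; exact: measurable_tnth.
Qed.

Lemma mean_refl w (f : d.-tuple R -> R) :
  bmf f -> mean mu (f \o refl w) = mean mu f.
Proof.
move=> bf.
rewrite -(mean_orth (householder_orth w) (@measurable_mulmx_tuple _) bf).
by apply: eq_mean => x /=; rewrite householder_refl.
Qed.

Lemma measurable_dot_self :
  measurable_fun setT (fun x : d.-tuple R => dot (tnth x) (tnth x)).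
Proof.
by apply: measurable_sum => j; apply: measurable_funM; exact: measurable_tnth.
Qed.

Lemma measurable_sphere : measurable (@sphere R d).
Proof.
have -> : sphere (d:=d) = (fun x => dot (tnth x) (tnth x)) @^-1` [set (1 : R)].
  by apply/seteqP; split.
by rewrite -[X in measurable X]setTI; apply: measurable_dot_self.
Qed.

Lemma bmf_sphere : bmf (\1_(@sphere R d) : d.-tuple R -> R).
Proof. exact: bmf_ind measurable_sphere. Qed.

(** The complement of the sphere is null, so integrands need only be compared on the sphere. *)
Lemma mean_sphere (f : d.-tuple R -> R) : bmf f ->
  mean mu (fun x => \1_(@sphere R d) x * f x) = mean mu f.
Proof.
move=> bf; have bSf := bmfM bmf_sphere bf.
case: bf (bf) => mf [M fM] bf.
apply/eqP; rewrite -subr_eq0 -meanB// -normr_le0.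
have /le_trans -> // : `|mean mu (fun x => \1_(@sphere R d) x * f x - f x)| <=
    mean mu (fun x => M * (1 - \1_(@sphere R d) x)).
  apply: mean_norm_le; first exact: bmfB.
    by apply: bmfZ; apply: bmfB; [exact: bmf_cst|exact: bmf_sphere].
  move=> x; rewrite indicE; case: (x \in _).
    by rewrite mul1r !subrr mulr0 normr0.
  by rewrite mul0r sub0r normrN subr0 mulr1.
rewrite meanZ; last by apply: bmfB; [exact: bmf_cst|exact: bmf_sphere].
rewrite meanB ?mean_cst; [|exact: bmf_cst|exact: bmf_sphere].
suff -> : mean mu \1_(@sphere R d) = 1 by rewrite subrr mulr0.
apply: EFin_inj; rewrite mean_ind; last exact: measurable_sphere.
by case: mu_unif.
Qed.

Lemma sphere_coord (x : d.-tuple R) i : sphere x -> `|tnth x i| <= 1.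
Proof.
move=> Sx; rewrite -(@expr_le1 _ 2)// -normrX ger0_norm ?sqr_ge0//.
rewrite -[leRHS]Sx /dotp (bigD1 i)//= expr2 lerDl.
by apply: sumr_ge0 => j _; rewrite -expr2 sqr_ge0.
Qed.

Lemma sphere_refl w (x : d.-tuple R) : sphere (refl w x) <-> sphere x.
Proof. by rewrite /sphere/= -![dotp _ _]/(dot _ _) dot_refl2. Qed.

End Uniform.

(** * Test functions and their Taylor bound *)

Section TestFunctions.
Context {R : realType}.
Implicit Types psi dpsi : R -> R.

(** The Lipschitz condition is restricted to [[-1, 1]], where the coordinates of a unit vector
    live. *)
Definition test_fun psi dpsi : Prop :=
  [/\ forall x : R, is_derive x 1 psi (dpsi x), measurable_fun setT dpsi &
      exists L : R, forall a b, `|a| <= 1 -> `|b| <= 1 ->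
        `|dpsi b - dpsi a| <= L * `|b - a| ].

Lemma test_fun_taylor psi dpsi : test_fun psi dpsi ->
  exists K : R, 0 <= K /\ forall a b, `|a| <= 1 -> `|b| <= 1 ->
    [/\ `|psi a| <= K, `|dpsi a| <= K &
        `|psi b - psi a - dpsi a * (b - a)| <= K * (b - a) ^+ 2].
Proof.
move=> [dpsiE _ [L Llip]].
have L0 : 0 <= L.
  have := Llip 0 1; rewrite normr0 normr1 subr0 ler01 lexx normr1 mulr1.
  by move=> /(_ isT isT); apply: le_trans.
have cpsi : continuous psi.
  move=> x; apply/differentiable_continuous/derivable1_diffP.
  by have [] := dpsiE x.
have mvt a b : a <= b -> exists2 c, c \in `[a, b]%R & psi b - psi a = dpsi c * (b - a).
  move=> ab; apply: MVT_segment => //.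
  exact/continuous_subspaceT.
have dbound a : `|a| <= 1 -> `|dpsi a| <= `|dpsi 0| + L.
  move=> a1; have := Llip 0 a; rewrite normr0 ler01 a1 subr0 => /(_ isT isT) h.
  rewrite -[dpsi a](subrK (dpsi 0)) addrC (le_trans (ler_normD _ _))// lerD2l.
  by rewrite (le_trans h)// ler_piMr.
have mvtn a b : `|a| <= 1 -> `|b| <= 1 ->
    exists c, [/\ `|c| <= 1, `|c - a| <= `|b - a| & psi b - psi a = dpsi c * (b - a)].
  rewrite !ler_norml => /andP[a1 a2] /andP[b1 b2].
  have [ab|ba] := leP a b.
    have [c] := mvt _ _ ab; rewrite in_itv/= => /andP[ac cb] E.
    exists c; split => //; first by rewrite ler_norml; apply/andP; split; lra.
    by rewrite !ger0_norm; lra.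
  have [c] := mvt _ _ (ltW ba); rewrite in_itv/= => /andP[ac cb] E.
  exists c; split => //; first by rewrite ler_norml; apply/andP; split; lra.
    by rewrite !ler0_norm; lra.
  by rewrite -[LHS]opprK opprB E; ring.
exists (`|psi 0| + (`|dpsi 0| + L)); split; first by rewrite !addr_ge0.
move=> a b a1 b1; split.
- have [|c [c1 _ E]] := mvtn 0 a _ a1; first by rewrite normr0.
  rewrite -[psi a](subrK (psi 0)) addrC (le_trans (ler_normD _ _))// lerD2l E.
  rewrite subr0 normrM -[leRHS]mulr1; apply: ler_pM => //; exact: dbound.
- by rewrite (le_trans (dbound _ a1))// lerDr.
- have [c [c1 ca ->]] := mvtn _ _ a1 b1.
  rewrite -mulrBl normrM -[(b - a) ^+ 2]ger0_norm ?sqr_ge0// normrX.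
  rewrite expr2 mulrA ler_wpM2r// (le_trans (Llip _ _ a1 c1))//.
  by apply: ler_pM => //; rewrite addrA lerDr addr_ge0.
Qed.

End TestFunctions.

(** * Integration by parts on the sphere *)

(* Second order expansion in [a] of [psi U * V], where [(U, V)] is the
   reflection of [(u, v)] through the line orthogonal to [(- a, 1)]; here
   [p = psi u], [q = dpsi u] and [P = psi U]. *)
Lemma reflection_expansion (R : realFieldType) (a u v U V p q P K : R) :
  0 <= a <= 1 -> `|u| <= 1 -> `|v| <= 1 -> `|V| <= 1 ->
  (1 + a ^+ 2) * U = (1 - a ^+ 2) * u + 2 * a * v ->
  (1 + a ^+ 2) * V = 2 * a * u - (1 - a ^+ 2) * v ->
  0 <= K -> `|p| <= K -> `|q| <= K -> `|P - p - q * (U - u)| <= K * (U - u) ^+ 2 ->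
  `|P * V + p * v + 2 * a * (q * v ^+ 2 - p * u)| <= 36 * K * a ^+ 2.
Proof.
move=> /andP[a0 a1] u1 v1 V1 DU DV K0 pK qK taylor.
have D1 : 1 <= 1 + a ^+ 2 by rewrite lerDl sqr_ge0.
(* Dividing by [1 + a ^+ 2 >= 1] only decreases norms, so each bound is read off a polynomial
   identity. *)
have divD x y : (1 + a ^+ 2) * x = y -> `|x| <= `|y|.
  move=> <-; rewrite normrM [`|1 + _|]ger0_norm ?(le_trans ler01)//.
  by rewrite ler_peMl.
have aa : a ^+ 2 <= a by rewrite expr2 ler_piMr.
have a20 := sqr_ge0 a.
have a3a : a ^+ 3 <= a ^+ 2 by rewrite (exprS _ 2) ler_piMl.
have a30 : 0 <= a ^+ 3 by rewrite exprn_ge0.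
have bnd (c e x y M : R) : 0 <= c -> 0 <= e -> `|x| <= 1 -> `|y| <= 1 -> c + e <= M ->
    `|c * x - e * y| <= M.
  move=> c0 e0 x1 y1 ceM; rewrite (le_trans (ler_normB _ _))// (le_trans _ ceM)//.
  by rewrite !normrM (ger0_norm c0) (ger0_norm e0) lerD// ler_piMr.
have h1 : `|U - u| <= 4 * a.
  have : (1 + a ^+ 2) * (U - u) = (2 * a) * v - (2 * a ^+ 2) * u.
    by rewrite mulrBr DU; ring.
  move/divD => /le_trans; apply; apply: bnd => //; nra.
have h2 : `|U - u - 2 * a * v| <= 4 * a ^+ 2.
  have : (1 + a ^+ 2) * (U - u - 2 * a * v) = (2 * a ^+ 2) * (- u) - (2 * a ^+ 3) * v.
    by rewrite !mulrBr DU; ring.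
  move/divD => /le_trans; apply; apply: bnd => //; rewrite ?normrN//; nra.
have h3 : `|V + v - 2 * a * u| <= 4 * a ^+ 2.
  have : (1 + a ^+ 2) * (V + v - 2 * a * u) = (2 * a ^+ 2) * v - (2 * a ^+ 3) * u.
    by rewrite mulrBr mulrDr DV; ring.
  move/divD => /le_trans; apply; apply: bnd => //; nra.
have h4 : `|V + v| <= 6 * a.
  rewrite -[V + v](subrK (2 * a * u)) (le_trans (ler_normD _ _))//.
  have : `|2 * a * u| <= 2 * a by rewrite normrM ger0_norm ?mulr_ge0// ler_piMr// mulr_ge0.
  nra.
(* The Taylor remainder of [psi], the second order error in [V], then those in [U] and in [v * V];
   the bounds 16, 4 and 4 + 12 add up to 36. *)
have -> : P * V + p * v + 2 * a * (q * v ^+ 2 - p * u) =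
    (P - p - q * (U - u)) * V + p * (V + v - 2 * a * u) +
    q * ((U - u - 2 * a * v) * V + 2 * a * (v * (V + v))) by ring.
have -> : 36 * K * a ^+ 2 = K * (16 * a ^+ 2) + K * (4 * a ^+ 2)
    + K * (4 * a ^+ 2 + 2 * a * (6 * a)) by ring.
rewrite (le_trans (ler_normD _ _))// lerD//.
  rewrite (le_trans (ler_normD _ _))// lerD//.
    rewrite normrM -[leRHS]mulr1 ler_pM// (le_trans taylor)// ler_wpM2l//.
    rewrite -[leLHS]ger0_norm ?sqr_ge0// normrX.
    have -> : 16 * a ^+ 2 = (4 * a) ^+ 2 by ring.
    by rewrite lerXn2r// nnegrE mulr_ge0.
  by rewrite normrM ler_pM.
rewrite normrM ler_pM// (le_trans (ler_normD _ _))// lerD//.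
  by rewrite normrM -[leRHS]mulr1 ler_pM.
rewrite normrM ger0_norm ?mulr_ge0// ler_wpM2l ?mulr_ge0//.
by rewrite normrM -[leRHS]mul1r ler_pM.
Qed.

Section Stein.
Context {R : realType} {d : nat}.
Variable mu : probability (d.-tuple R) R.
Hypothesis mu_unif : uniform_on_sphere mu.

(** This is [e_j - a e_i]: the reflection along it moves only the coordinates [i] and [j], and for
    [a = 0] it is the sign change of [x_j]. *)
Definition tilt (i j : 'I_d) (a : R) : 'I_d -> R :=
  fun l => (l == j)%:R - a * (l == i)%:R.

Lemma dot_tilt (i j : 'I_d) (a : R) (b : 'I_d -> R) :
  dot b (tilt i j a) = b j - a * b i.
Proof.
have dotE k : dot b (fun l => (l == k)%:R) = b k.
  rewrite -[RHS](sum_delta k) dotC.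
  by apply: eq_bigr => l _; rewrite eq_sym.
by rewrite (dotBr (fun l => (l == j)%:R)) dotZr !dotE.
Qed.

Lemma tilt_norm (i j : 'I_d) (a : R) : i != j ->
  dot (tilt i j a) (tilt i j a) = 1 + a ^+ 2.
Proof.
move=> ij; by rewrite dot_tilt /tilt !eqxx (eq_sym j) !(negPf ij) /=; ring.
Qed.

Lemma refl_tilt_other (i j l : 'I_d) (a : R) x : l != i -> l != j ->
  tnth (refl (tilt i j a) x) l = tnth x l.
Proof.
by move=> li lj; rewrite tnth_mktuple /tilt (negPf li) (negPf lj) /=; ring.
Qed.

(** The function [H = psi(x_i) x_j f] and its image under the reflection along [tilt i j a] have the
    same mean. Expanding in [a] gives [2 E H + 2 a (E G - E F) = O(a^2)]: the term of order 0
    vanishes, then the one of order 1. *)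
Lemma stein_identity psi dpsi (f : d.-tuple R -> R) (i j : 'I_d) : i != j ->
  test_fun psi dpsi -> bmf f -> (forall x, ~ sphere x -> f x = 0) ->
  (forall a x, f (refl (tilt i j a) x) = f x) ->
  let G x := dpsi (tnth x i) * tnth x j ^+ 2 * f x in
  let F x := psi (tnth x i) * tnth x i * f x in
  [/\ bmf G, bmf F & mean mu G = mean mu F].
Proof.
move=> ij tf bf fS finv G F.
have [K [K0 taylor]] := test_fun_taylor tf.
have [dpsiE mdpsi _] := tf.
have mpsi : measurable_fun setT psi.
  apply: continuous_measurable_fun => x.
  apply/differentiable_continuous/derivable1_diffP.
  by have [] := dpsiE x.
have bounded_on_sphere (g : d.-tuple R -> R) (M : R) : measurable_fun setT g ->
    (forall x, sphere x -> `|g x| <= M) -> bmf (fun x => g x * f x).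
  move=> mg gM; have [mf [N fN]] := bf.
  split; first exact: measurable_funM.
  exists (`|M| * N) => x; have [Sx|Sx] := pselect (sphere x).
    by rewrite normrM ler_pM// (le_trans (gM _ Sx))// ler_norm.
  by rewrite fS// mulr0 normr0 mulr_ge0// (le_trans _ (fN x)).
have mt l : measurable_fun setT (fun x : d.-tuple R => tnth x l).
  exact: measurable_tnth.
have sc (l : 'I_d) (x : d.-tuple R) : sphere x -> `|tnth x l| <= 1 by exact: sphere_coord.
have mpi l : measurable_fun setT (fun x : d.-tuple R => psi (tnth x l)).
  exact: (measurableT_comp mpsi (mt l)).
have mdi l : measurable_fun setT (fun x : d.-tuple R => dpsi (tnth x l)).
  exact: (measurableT_comp mdpsi (mt l)).
have bF : bmf F.
  apply: (bounded_on_sphere _ (K * 1)); first exact: measurable_funM.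
  move=> x Sx; rewrite normrM ler_pM// ?sc//.
  by have [] := taylor _ _ (sc i x Sx) (sc i x Sx).
have bG : bmf G.
  apply: (bounded_on_sphere _ (K * 1)).
    by apply: measurable_funM => //; apply: measurable_funX.
  move=> x Sx; rewrite normrM ler_pM//; last by rewrite normrX exprn_ile1// sc.
  by have [] := taylor _ _ (sc i x Sx) (sc i x Sx).
split => //.
pose H x := psi (tnth x i) * tnth x j * f x.
have bH : bmf H.
  apply: (bounded_on_sphere _ (K * 1)); first exact: measurable_funM.
  move=> x Sx; rewrite normrM ler_pM// ?sc//.
  by have [] := taylor _ _ (sc i x Sx) (sc i x Sx).
have [_ [M fM]] := bf.
have key a : 0 <= a <= 1 ->
    `|2 * mean mu H + 2 * a * (mean mu G - mean mu F)| <= 36 * K * M * a ^+ 2.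
  move=> a01.
  have bHr : bmf (H \o refl (tilt i j a)) by apply: bmf_comp => //; exact: measurable_refl.
  have -> : 2 * mean mu H + 2 * a * (mean mu G - mean mu F) =
      mean mu (fun x => H (refl (tilt i j a) x) + H x + 2 * a * (G x - F x)).
    have bGF := bmfB bG bF.
    rewrite meanD ?meanD ?meanZ ?meanB//; [|exact: bmfD|exact: bmfZ].
    by rewrite [in RHS](mean_refl mu_unif _ bH); ring.
  rewrite -[leRHS](mean_cst mu); apply: mean_norm_le.
  - by apply: bmfD; [exact: bmfD|apply: bmfZ; exact: bmfB].
  - exact: bmf_cst.
  move=> x; have [Sx|Sx] := pselect (sphere x); last first.
    have Sr : ~ sphere (refl (tilt i j a) x) by rewrite sphere_refl.
    rewrite /H /G /F !fS// !mulr0 subrr mulr0 !addr0 normr0.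
    by rewrite mulr_ge0 ?sqr_ge0// mulr_ge0 ?mulr_ge0// (le_trans _ (fM x)).
  have Sr : sphere (refl (tilt i j a) x) by rewrite sphere_refl.
  rewrite /H /G /F finv.
  set y := refl _ x in Sr *.
  have -> : psi (tnth y i) * tnth y j * f x + psi (tnth x i) * tnth x j * f x +
      2 * a * (dpsi (tnth x i) * tnth x j ^+ 2 * f x - psi (tnth x i) * tnth x i * f x) =
      (psi (tnth y i) * tnth y j + psi (tnth x i) * tnth x j +
      2 * a * (dpsi (tnth x i) * tnth x j ^+ 2 - psi (tnth x i) * tnth x i)) * f x by ring.
  rewrite normrM (_ : _ * a ^+ 2 = 36 * K * a ^+ 2 * M); last by ring.
  have a2 : 1 + a ^+ 2 != 0 by rewrite gt_eqF// ltr_wpDr ?sqr_ge0.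
  have [? ? ?] := taylor _ _ (sc i x Sx) (sc i y Sr).
  apply: ler_pM => //; apply: (@reflection_expansion _ _ _ _ (tnth y i) _ _ (dpsi (tnth x i))) => //; rewrite ?sc//.
    rewrite tnth_mktuple dot_tilt tilt_norm// /tilt eqxx (negPf ij) /=.
    by field.
  rewrite tnth_mktuple dot_tilt tilt_norm// /tilt eqxx (eq_sym j) (negPf ij) /=.
  by field.
have H0 : mean mu H = 0.
  have := key 0; rewrite lexx ler01 expr0n/= !mulr0 mul0r addr0 => /(_ isT).
  by rewrite normr_le0 mulf_eq0 pnatr_eq0/= => /eqP.
apply/eqP; rewrite -subr_eq0; apply/negPn/negP => D0.
set D := mean mu G - mean mu F in key D0.
have {D0}D0 : 0 < `|D| by rewrite normr_gt0.
pose C := 36 * K * M.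
have C0 : 0 <= C.
  by have := key 1; rewrite ler01 lexx expr1n !mulr1 => /(_ isT) h; exact: le_trans (normr_ge0 _) h.
(* For this [a] one has [C a <= |D|], against the bound [2 |D| <= C a] obtained from [key]. *)
pose a := Num.min 1 (`|D| / (C + 1)).
have a0 : 0 < a by rewrite lt_min ltr01 divr_gt0// ltr_wpDl.
have := key a; rewrite ltW//= ge_min lexx/= => /(_ isT).
rewrite H0 mulr0 add0r normrM (@ger0_norm _ (2 * a)) ?mulr_ge0 ?(ltW a0)//.
rewrite -/C => h.
have {}h : 2 * `|D| <= C * a.
  rewrite -(ler_pM2r a0); apply: le_trans (le_trans h _); last by rewrite expr2 mulrA.
  by rewrite mulrAC.
have : C * a <= `|D|.
  rewrite (@le_trans _ _ (C * (`|D| / (C + 1))))// ?ler_wpM2l// ?ge_min ?lexx ?orbT//.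
  by rewrite mulrA ler_pdivrMr ?ltr_wpDl// mulrC ler_wpM2l// lerDl.
by move=> h'; have := le_trans h h'; lra.
Qed.
End Stein.

(** * The identity, the arctangent and a Gaussian weight as test functions *)

Section TestFunctionExamples.
Context {R : realType}.

Lemma test_fun_id : test_fun (@id R) (fun=> 1).
Proof.
split; [by move=> x; exact: is_derive_id|exact: measurable_cst|].
by exists 0 => a b _ _; rewrite subrr normr0 mul0r.
Qed.

Lemma sqr_lip (a b : R) : `|a| <= 1 -> `|b| <= 1 ->
  `|b ^+ 2 - a ^+ 2| <= 2 * `|b - a|.
Proof.
move=> a1 b1; rewrite subr_sqr normrM mulrC ler_wpM2r//.
by rewrite (le_trans (ler_normD _ _))// (_ : 2 = 1 + 1)// lerD.
Qed.

(** With [s = 1 / t], a bounded function whose derivative is a Cauchy kernel of width [t], a smooth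
    substitute for the indicator of [|y| <= t]. *)
Lemma test_fun_atan (s : R) : 0 < s ->
  test_fun (fun y => atan (s * y)) (fun y => s / (1 + (s * y) ^+ 2)).
Proof.
move=> s0.
have D1 (y : R) : 1 <= 1 + (s * y) ^+ 2 by rewrite lerDl sqr_ge0.
have D0 (y : R) : 0 < 1 + (s * y) ^+ 2 by rewrite (lt_le_trans ltr01).
split.
- move=> x.
  have h : is_derive x 1 ( *%R s) s.
    apply: (is_derive_eq (@is_deriveZ R R R id s x 1 1 (is_derive_id _ _))).
    by rewrite /GRing.scale /= mulr1.
  apply: (is_derive_eq (is_derive1_comp (is_derive1_atan (s * x)) h)).
  by rewrite mulrC.
- apply: continuous_measurable_fun => x.
  apply: cvgM; first exact: cvg_cst.
  apply: cvgV; first by rewrite gt_eqF.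
  apply: cvgD; first exact: cvg_cst.
  rewrite (_ : (fun y => (s * y) ^+ 2) = (fun y => s * y * (s * y)))//.
  apply: cvgM; apply: cvgM; do ?exact: cvg_cst; exact: cvg_id.
- exists (s * (s ^+ 2 * 2)) => a b a1 b1.
  have -> : s / (1 + (s * b) ^+ 2) - s / (1 + (s * a) ^+ 2) =
      s * (s ^+ 2 * (a ^+ 2 - b ^+ 2)) / ((1 + (s * b) ^+ 2) * (1 + (s * a) ^+ 2)).
    by field; rewrite !gt_eqF.
  rewrite normrM normfV [X in _ / X]ger0_norm; last by rewrite mulr_ge0// ltW.
  rewrite ler_pdivrMr ?mulr_gt0// (@le_trans _ _ (s * (s ^+ 2 * 2) * `|b - a|))//.
    rewrite 2!normrM (ger0_norm (ltW s0)) (@ger0_norm _ (s ^+ 2)) ?sqr_ge0// -!mulrA.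
    by do 3![apply: ler_wpM2l; rewrite ?(ltW s0)//]; rewrite distrC sqr_lip.
  by rewrite ler_peMr ?mulr_ge0 ?(ltW s0)// ?exprn_ge0 ?(ltW s0)// mulr_ege1.
Qed.

Lemma expR_lip (a b M : R) : a <= M -> b <= M ->
  `|expR b - expR a| <= expR M * `|b - a|.
Proof.
wlog ab : a b / a <= b.
  by move=> H aM bM; have [ab|/ltW ba] := leP a b; [exact: H|rewrite distrC (distrC b) H].
move=> aM bM; rewrite !ger0_norm ?subr_ge0 ?ler_expR//.
have /= := expR_ge1Dx (a - b); rewrite -(ler_pM2l (expR_gt0 b)) -expRD.
rewrite (addrC b) subrK => h.
apply: (@le_trans _ _ (expR b * (b - a))); first lra.
by rewrite ler_wpM2r ?subr_ge0// ler_expR.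
Qed.

(** Chosen so that [psi(y) y] is [y^2 exp(k y^2)]: [stein_identity] then controls the second moment
    under an exponential weight by the weight itself. *)
Lemma test_fun_gauss (k : R) : 0 <= k ->
  test_fun (fun y => y * expR (k * y ^+ 2))
           (fun y => (1 + 2 * k * y ^+ 2) * expR (k * y ^+ 2)).
Proof.
move=> k0.
have cs (c : R) : continuous (fun y : R => c * y ^+ 2).
  move=> x; apply: cvgM; first exact: cvg_cst.
  rewrite (_ : (fun y => y ^+ 2) = (fun y : R => y * y))//.
  by apply: cvgM; exact: cvg_id.
split.
- move=> x.
  have h : is_derive x 1 (fun y : R => k * y ^+ 2) (k * (2 * x)).
    have xx := @is_deriveM R R id id x 1 1 1 (is_derive_id _ _) (is_derive_id _ _).
    apply: (is_derive_eq (@is_deriveZ R R R _ k x 1 _ xx)).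
    by rewrite /GRing.scale /=; ring.
  have h2 : is_derive x 1 (fun y : R => expR (k * y ^+ 2)) (k * (2 * x) * expR (k * x ^+ 2)).
    by apply: (is_derive_eq (@is_derive1_comp R expR (fun y => k * y ^+ 2) x _ _ (is_derive_expR _) h)); rewrite mulrC.
  apply: (is_derive_eq (@is_deriveM R R id _ x 1 1 _ (is_derive_id _ _) h2)).
  by rewrite /GRing.scale /=; ring.
- apply: continuous_measurable_fun => x.
  apply: cvgM; first by apply: cvgD; [exact: cvg_cst|exact: cs].
  by apply: continuous_comp; [exact: cs|exact: continuous_expR].
- exists ((1 + 2 * k) * (expR k * (k * 2)) + 2 * k * 2 * expR k) => a b a1 b1.
  have sq1 (y : R) : `|y| <= 1 -> 0 <= y ^+ 2 <= 1.
    by move=> y1; rewrite sqr_ge0 -[_ ^+ _]ger0_norm ?sqr_ge0// normrX exprn_ile1.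
  have kk (y : R) : `|y| <= 1 -> k * y ^+ 2 <= k.
    by move=> /sq1/andP[_ y1]; rewrite ler_piMr.
  have -> : (1 + 2 * k * b ^+ 2) * expR (k * b ^+ 2) -
      (1 + 2 * k * a ^+ 2) * expR (k * a ^+ 2) =
      (1 + 2 * k * b ^+ 2) * (expR (k * b ^+ 2) - expR (k * a ^+ 2)) +
      2 * k * ((b ^+ 2 - a ^+ 2) * expR (k * a ^+ 2)) by ring.
  rewrite (le_trans (ler_normD _ _))// [leRHS]mulrDl lerD//.
    rewrite normrM -[leRHS]mulrA; apply: ler_pM => //.
      have kb := kk _ b1; have kb0 : 0 <= k * b ^+ 2 by rewrite mulr_ge0// sqr_ge0.
      by rewrite ger0_norm; lra.
    rewrite (le_trans (expR_lip (kk _ a1) (kk _ b1)))// -mulrA ler_wpM2l ?expR_ge0//.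
    by rewrite -mulrBr normrM (ger0_norm k0) -mulrA ler_wpM2l// sqr_lip.
  rewrite normrM (@ger0_norm _ (2 * k)) ?mulr_ge0// -!mulrA ler_wpM2l// ler_wpM2l//.
  rewrite normrM [leRHS](_ : _ = 2 * `|b - a| * expR k); last by ring.
  apply: ler_pM => //.
    exact: sqr_lip.
  by rewrite ger0_norm ?expR_ge0// ler_expR kk.
Qed.

End TestFunctionExamples.

(** * Small balls and tails *)

Section Peeling.
Context {R : realType} {d : nat}.
Variable mu : probability (d.-tuple R) R.
Hypothesis mu_unif : uniform_on_sphere mu.
Variable phi : R -> R.
Hypothesis mphi : measurable_fun setT phi.
Hypothesis phi_ge0 : forall y, 0 <= phi y.
Variable M : R.
Hypothesis phi_le : forall y, `|y| <= 1 -> phi y <= M.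
Implicit Types (D : {set 'I_d}) (x : d.-tuple R) (i j : 'I_d).

(** Constraints or weights on the coordinates in [D], cut off outside the sphere. Reflections that
    move only coordinates outside [D] leave it unchanged, so coordinates can be removed from [D] one
    at a time. *)
Definition restr D x : R := \1_(@sphere R d) x * \prod_(l in D) phi (tnth x l).

Lemma restr_off D x : ~ sphere x -> restr D x = 0.
Proof. by move=> Sx; rewrite /restr indicE memNset// mul0r. Qed.

Lemma restr_on D x : sphere x -> restr D x = \prod_(l in D) phi (tnth x l).
Proof. by move=> Sx; rewrite /restr indicE mem_set// mul1r. Qed.

Lemma restr_ge0 D x : 0 <= restr D x.
Proof.
by rewrite /restr mulr_ge0 ?prodr_ge0// indicE; case: (_ \in _).
Qed.

Lemma restrU1 D i x : i \notin D -> restr (i |: D) x = phi (tnth x i) * restr D x.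
Proof. by move=> iD; rewrite /restr big_setU1//= mulrCA. Qed.

Lemma restr_tilt D i j a x : i \notin D -> j \notin D ->
  restr D (refl (tilt i j a) x) = restr D x.
Proof.
move=> iD jD; have [Sx|Sx] := pselect (sphere x); last first.
  by rewrite !restr_off// sphere_refl.
rewrite !restr_on ?sphere_refl//; apply: eq_bigr => l lD.
by rewrite refl_tilt_other//; [apply: contraNneq iD => <-|apply: contraNneq jD => <-].
Qed.

Lemma M_ge0 : 0 <= M.
Proof. by rewrite (le_trans (phi_ge0 0))// phi_le// normr0. Qed.

Lemma bmf_restr D : bmf (restr D).
Proof.
split.
  apply: measurable_funM; first by apply: measurable_indic; exact: measurable_sphere.
  rewrite (_ : (fun x => _) = fun x => \prod_(l <- enum D) phi (tnth x l)).
    apply: measurable_prod => l _.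
    exact: (measurableT_comp mphi (measurable_tnth l)).
  by apply/funext => x; rewrite big_enum.
exists (M ^+ #|D|) => x; rewrite ger0_norm ?restr_ge0//.
have [Sx|Sx] := pselect (sphere x); last by rewrite restr_off// exprn_ge0// M_ge0.
rewrite restr_on// -prodr_const ler_prod// => l _.
by rewrite phi_ge0 phi_le//; exact: sphere_coord.
Qed.

Lemma mean_restr0 : mean mu (restr finset.set0) = 1.
Proof.
rewrite -[RHS](mean_cst mu) -[RHS](mean_sphere mu_unif); last exact: bmf_cst.
by apply: eq_mean => x; rewrite /restr big_set0.
Qed.

(** [stein_identity] summed over all [j] outside [i |: D]. On the sphere the sum [rest] is at most
    1, and this is how a factor [d] is gained. *)
Lemma stein_restr psi dpsi D i : i \notin D -> (#|D|.+1 < d)%N ->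
  test_fun psi dpsi ->
  let rest x := \sum_(j in ~: (i |: D)) tnth x j ^+ 2 in
  let G x := dpsi (tnth x i) * rest x * restr D x in
  let F x := psi (tnth x i) * tnth x i * restr D x in
  [/\ bmf G, bmf F & mean mu G = (d - #|D|.+1)%:R * mean mu F].
Proof.
move=> iD Dd tf rest G F.
have st j : j \in ~: (i |: D) -> let Gj x := dpsi (tnth x i) * tnth x j ^+ 2 * restr D x in
    [/\ bmf Gj, bmf F & mean mu Gj = mean mu F].
  rewrite !inE negb_or => /andP[ji jD].
  apply: (stein_identity mu_unif) => //; first by rewrite eq_sym.
  - exact: bmf_restr.
  - exact: restr_off.
  - by move=> a x; exact: restr_tilt.
have GE : G =1 fun x => \sum_(j in ~: (i |: D)) dpsi (tnth x i) * tnth x j ^+ 2 * restr D x.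
  by move=> x; rewrite /G /rest mulr_sumr mulr_suml.
have cardE : #|~: (i |: D)| = (d - #|D|.+1)%N.
  by rewrite cardsCs finset.setCK cardsU1 iD card_ord.
split.
- apply: (eq_bmf (fsym GE)); apply: bmf_sum => j jD; by have [] := st j jD.
(* Boundedness of [F] is read off any one such [j]; there is one because [#|D|.+1 < d]. *)
- move: Dd; rewrite -subn_gt0 -cardE card_gt0 => /set0Pn[j jD]; by have [] := st j jD.
- rewrite (eq_mean _ GE) mean_sum; last by move=> j jD; have [] := st j jD.
  rewrite (eq_bigr (fun=> mean mu F)); last by move=> j jD; have [] := st j jD.
  by rewrite sumr_const cardE mulr_natl.
Qed.

Lemma sum_sphere D x : sphere x ->
  \sum_(j in ~: D) tnth x j ^+ 2 = 1 - \sum_(j in D) tnth x j ^+ 2.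
Proof.
move=> Sx; apply/eqP; rewrite eq_sym subr_eq addrC -[X in X == _]Sx /dotp.
rewrite (bigID (mem D))/=; by apply/eqP; congr (_ + _); apply: eq_bigl => j; rewrite ?inE.
Qed.

(** [stein_restr] with [psi] the identity; the factor [d - #|D|.+1] is at least [d / 2]. *)
Lemma second_moment_restr D i : i \notin D -> (#|D|.+1.*2 <= d)%N ->
  bmf (fun x => tnth x i ^+ 2 * restr D x) /\
  mean mu (fun x => tnth x i ^+ 2 * restr D x) <= 2 / d%:R * mean mu (restr D).
Proof.
move=> iD Dd.
have Dd1 : (#|D|.+1 < d)%N by move: Dd; set k := #|D|; lia.
have d0 : 0 < d%:R :> R by rewrite ltr0n (leq_trans _ Dd1).
have [bG bF E] := stein_restr iD Dd1 test_fun_id.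
rewrite (_ : (fun x => id (tnth x i) * tnth x i * restr D x) =
  fun x => tnth x i ^+ 2 * restr D x) in bF E; last by [].
split=> //; set m := mean mu (fun x => tnth x i ^+ 2 * restr D x) in E *.
have m0 : 0 <= m by apply: mean_ge0 => x; rewrite mulr_ge0 ?sqr_ge0 ?restr_ge0.
rewrite mulrAC ler_pdivlMr//.
have : (d - #|D|.+1)%:R * m <= mean mu (restr D).
  rewrite -E; apply: le_mean => //; first exact: bmf_restr.
  move=> x; rewrite mul1r; have [Sx|Sx] := pselect (sphere x); last first.
    by rewrite !restr_off// mulr0.
  rewrite ler_piMl ?restr_ge0// sum_sphere// lerBlDr lerDl sumr_ge0// => j _.
  by rewrite sqr_ge0.
move=> h; rewrite mulrC (le_trans _ (ler_wpM2l _ h))// mulrA ler_wpM2r//.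
by rewrite -natrM ler_nat; move: Dd; set k := #|D|; lia.
Qed.

End Peeling.

Section SphereEstimates.
Context {R : realType} {d : nat}.
Variable mu : probability (d.-tuple R) R.
Hypothesis mu_unif : uniform_on_sphere mu.
Implicit Types (D : {set 'I_d}) (x : d.-tuple R).

Lemma atan_le2 (y : R) : `|atan y| <= 2.
Proof.
have := atan_ltpi2 y; have := atan_gtNpi2 y.
have /andP[_] := pihalf_02 R.
by rewrite ler_norml => ? ? ?; apply/andP; split; lra.
Qed.

(** The kernel [1 / (1 + (y / t)^2)] is at least 1/2 where [|y| <= t]. *)
Lemma indicator_le_datan (t y : R) : 0 < t ->
  (y ^+ 2 <= t ^+ 2)%R%:R <= 2 * t * (t^-1 / (1 + (t^-1 * y) ^+ 2)).
Proof.
move=> t0; have ty0 : 0 <= (t^-1 * y) ^+ 2 by rewrite sqr_ge0.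
have -> : 2 * t * (t^-1 / (1 + (t^-1 * y) ^+ 2)) = 2 / (1 + (t^-1 * y) ^+ 2).
  by rewrite mulrA mulfK// gt_eqF.
have D0 : 0 < 1 + (t^-1 * y) ^+ 2 by rewrite ltr_wpDr.
have [yt|_] := boolP (y ^+ 2 <= t ^+ 2); last by rewrite divr_ge0// ltW.
rewrite ler_pdivlMr// mul1r exprMn exprVn mulrC.
rewrite (_ : 2 = 1 + 1)// lerD2l ler_pdivrMr ?exprn_gt0//.
by rewrite mul1r.
Qed.

(* On the event the free coordinates carry at least half of the mass, so that one
   constraint [x_i ^+ 2 <= t ^+ 2] may be multiplied by twice the sum of their
   squares; [stein_restr] with [psi y = atan (y / t)] then trades these squares for
   [`|x_i|], whose mean is at most [O(1 / sqrt d)]. *)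
Lemma small_ball D (t : R) : 0 < t -> (#|D|.*2 <= d)%N -> #|D|%:R * t ^+ 2 <= 1 / 2 ->
  mean mu (restr (fun y => (y ^+ 2 <= t ^+ 2)%R%:R) D) <= (12 * t * Num.sqrt d%:R) ^+ #|D|.
Proof.
move=> t0; set phi := fun y : R => (y ^+ 2 <= t ^+ 2)%R%:R : R.
have phi0 y : 0 <= phi y by rewrite ler0n.
have phi1 y : `|y| <= 1 -> phi y <= 1 by rewrite lern1 leq_b1.
have mphi : measurable_fun setT phi.
  rewrite (_ : phi = \1_[set y | y ^+ 2 <= t ^+ 2]); last first.
    apply/funext => y; rewrite indicE /phi; congr (nat_of_bool _)%:R.
    by apply/idP/idP => [yt|/set_mem//]; exact/mem_set.
  apply: measurable_indic.
  rewrite -[X in measurable X]setTI.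
  apply: (@measurable_fun_ler _ _ _ setT (fun y : R => y ^+ 2) (fun=> t ^+ 2)) => //.
move: {2}#|D| (erefl #|D|) => k; elim: k D => [|k IH] D.
  move/eqP; rewrite cards_eq0 => /eqP-> _ _.
  by rewrite cards0 expr0 (mean_restr0 mu_unif).
move=> Dk; have /set0Pn[i iD] : D != finset.set0 by rewrite -card_gt0 Dk.
pose E := D :\ i; have iE : i \notin E by rewrite !inE eqxx.
have DE : D = i |: E by rewrite finset.setD1K.
have Ek : #|E| = k by move: Dk; rewrite (cardsD1 i) iD => -[].
rewrite Dk => dk kt.
have Ed : (#|E|.+1.*2 <= d)%N by rewrite Ek.
have Ed1 : (#|E|.+1 < d)%N by move: dk; rewrite Ek; lia.
have d0 : 0 < d%:R :> R by rewrite ltr0n (leq_trans _ Ed1).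
pose sd : R := Num.sqrt d%:R; have sd0 : 0 < sd by rewrite sqrtr_gt0.
have sdE : d%:R = sd ^+ 2 :> R by rewrite sqr_sqrtr// ltW.
pose f := restr phi E.
have bf : bmf f by exact: (bmf_restr mphi phi0 phi1).
have f0 x : 0 <= f x by exact: restr_ge0.
have {}IH : mean mu f <= (12 * t * sd) ^+ k.
  rewrite -Ek; apply: IH => //; first by rewrite Ek; move: dk; lia.
  by rewrite Ek (le_trans _ kt)// ler_wpM2r ?sqr_ge0// ler_nat.
rewrite -/sd [leRHS]exprS (le_trans _ (ler_wpM2l _ IH))//; last by rewrite !mulr_ge0// ltW.
have tV0 : 0 < t^-1 by rewrite invr_gt0.
have [bG bF GF] := stein_restr mu_unif mphi phi0 phi1 iE Ed1 (test_fun_atan tV0).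
have [bm hm] := second_moment_restr mu_unif mphi phi0 phi1 iE Ed.
rewrite -/f in bm hm.
set F := (X in bmf X) in bF; set G := (X in bmf X) in bG.
have bD : bmf (restr phi D) by exact: (bmf_restr mphi phi0 phi1).
(* A factor [2 t] bounds the indicator by the kernel, and a factor 2 pays for the free squares,
   whose sum is at least 1/2. *)
have step1 : mean mu (restr phi D) <= 4 * t * mean mu G.
  rewrite -meanZ//; apply: le_mean => //; first exact: bmfZ.
  move=> x; rewrite /G -/f.
  have R0 : 0 <= 4 * t * (t^-1 / (1 + (t^-1 * tnth x i) ^+ 2) *
      (\sum_(j in ~: (i |: E)) tnth x j ^+ 2) * f x).
    apply: mulr_ge0; first by rewrite mulr_ge0// ltW.
    apply: mulr_ge0; last exact: f0.
    apply: mulr_ge0; first by rewrite divr_ge0 ?addr_ge0 ?sqr_ge0// ltW.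
    by rewrite sumr_ge0// => j _; rewrite sqr_ge0.
  have [->//|nz] := eqVneq (restr phi D x) 0.
  have Sx : sphere x by apply/not_notP => nS; move: nz; rewrite restr_off ?eqxx.
  have half : 1 / 2 <= \sum_(j in ~: (i |: E)) tnth x j ^+ 2.
    rewrite sum_sphere// lerBrDr -lerBrDl (_ : 1 - 1 / 2 = 1 / 2); last by field.
    rewrite (le_trans _ kt)// -Dk DE mulr_natl -sumr_const ler_sum// -DE => l lD.
    move: nz; rewrite restr_on// => /prodf_neq0/(_ l lD).
    by rewrite /phi; case: (tnth x l ^+ 2 <= t ^+ 2); rewrite ?eqxx.
  rewrite {1}DE restrU1// -/f.
  apply: (@le_trans _ _ (2 * t * (t^-1 / (1 + (t^-1 * tnth x i) ^+ 2)) * f x)).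
    by rewrite ler_wpM2r// indicator_le_datan.
  have : 0 <= t^-1 / (1 + (t^-1 * tnth x i) ^+ 2).
    by rewrite divr_ge0 ?addr_ge0 ?sqr_ge0// ltW.
  move: half (f0 x); move: (t^-1 / _) (\sum_(j in _) _) (f x) => A S u S2 u0 A0.
  rewrite (_ : 4 * t * (A * S * u) = 2 * t * A * u * (2 * S)); last by ring.
  by rewrite ler_peMr ?mulr_ge0 ?(ltW t0)//; lra.
(* From [|atan| <= 2] and [2 |x_i| <= sd x_i^2 + 1 / sd]; the second moment bound [2 / d] turns this
   into [2 / sd + 1 / sd]. Together with [4 t] this gives the constant 12. *)
have step2 : mean mu F <= 3 / sd * mean mu f.
  have : mean mu F <= mean mu (fun x => sd * (tnth x i ^+ 2 * f x) + sd^-1 * f x).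
    apply: le_mean => //; first by apply: bmfD; exact: bmfZ.
    move=> x; rewrite /F -/f mulrA -mulrDl ler_wpM2r//.
    apply: (le_trans (ler_norm _)); rewrite normrM.
    apply: (@le_trans _ _ (2 * `|tnth x i|)); first by rewrite ler_wpM2r// atan_le2.
    rewrite -subr_ge0 -[X in sd * X]ger0_norm ?sqr_ge0// normrX.
    have -> : sd * `|tnth x i| ^+ 2 + sd^-1 - 2 * `|tnth x i| =
      (sd * `|tnth x i| - 1) ^+ 2 / sd by field; rewrite gt_eqF.
    by rewrite divr_ge0 ?sqr_ge0// ltW.
  rewrite meanD ?meanZ//; [|exact: bmfZ|exact: bmfZ].
  move=> /le_trans; apply.
  rewrite (_ : 3 / sd = sd * (2 / d%:R) + sd^-1); last first.
    by rewrite sdE; field; rewrite gt_eqF.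
  by rewrite mulrDl lerD2r -mulrA ler_wpM2l// ltW.
apply: (le_trans step1); rewrite GF -/f.
have mf0 : 0 <= mean mu f by exact: mean_ge0.
apply: (@le_trans _ _ (4 * t * (d%:R * (3 / sd * mean mu f)))).
  rewrite ler_wpM2l ?mulr_ge0 ?(ltW t0)//.
  apply: (@le_trans _ _ ((d - #|E|.+1)%:R * (3 / sd * mean mu f))).
    by rewrite ler_wpM2l.
  by rewrite ler_wpM2r ?ler_nat ?leq_subr// mulr_ge0// divr_ge0// ltW.
rewrite le_eqVlt; apply/orP; left; apply/eqP.
by rewrite -/sd sdE; field; rewrite gt_eqF.
Qed.

End SphereEstimates.

(** * Exponential moments and tails *)

Section Tail.
Context {R : realType} {d : nat}.
Variable mu : probability (d.-tuple R) R.
Hypothesis mu_unif : uniform_on_sphere mu.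
Implicit Types (D : {set 'I_d}) (x : d.-tuple R).

Let gauss (y : R) : R := expR (d%:R / 8 * y ^+ 2).

Let gauss_ge0 y : 0 <= gauss y. Proof. exact: expR_ge0. Qed.

Let gauss_le (y : R) : `|y| <= 1 -> gauss y <= expR (d%:R / 8).
Proof.
move=> y1; rewrite ler_expR ler_piMr//.
by rewrite -[_ ^+ _]ger0_norm ?sqr_ge0// normrX exprn_ile1.
Qed.

Let measurable_gauss : measurable_fun setT gauss.
Proof.
apply: measurableT_comp; first exact: measurable_expR.
by apply: measurable_funM => //; exact: exprn_measurable.
Qed.

(** Let [a] be the moment over [D], [b] the same with an extra factor [x_i^2], and [m] the moment
    over [D :\ i]. [stein_restr] gives [(3/4) d b <= a + (d/4) b], so [d b <= 2 a]; and
    [exp u <= e + u exp u] gives [a <= e m + (d/8) b <= e m + a/4]. The weight [d/8] is small enough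
    for both self-referring terms to be absorbed. *)
Lemma gaussian_moment D : (#|D| * 4 <= d)%N ->
  mean mu (restr gauss D) <= (2 * expR 1) ^+ #|D|.
Proof.
move: {2}#|D| (erefl #|D|) => k; elim: k D => [|k IH] D.
  move/eqP; rewrite cards_eq0 => /eqP-> _.
  by rewrite cards0 expr0 (mean_restr0 mu_unif).
move=> Dk; have /set0Pn[i iD] : D != finset.set0 by rewrite -card_gt0 Dk.
pose E := D :\ i; have iE : i \notin E by rewrite !inE eqxx.
have DE : D = i |: E by rewrite finset.setD1K.
have Ek : #|E| = k by move: Dk; rewrite (cardsD1 i) iD => -[].
rewrite Dk => dk.
have Ed1 : (#|E|.+1 < d)%N by move: dk; rewrite Ek; lia.
have d0 : 0 < d%:R :> R by rewrite ltr0n (leq_trans _ Ed1).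
pose f := restr gauss E.
have bf : bmf f by exact: (bmf_restr measurable_gauss gauss_ge0 gauss_le).
have f0 x : 0 <= f x by exact: restr_ge0.
have {}IH : mean mu f <= (2 * expR 1) ^+ k.
  by rewrite -Ek; apply: IH => //; rewrite Ek; move: dk; lia.
have e0 : 0 <= 2 * expR 1 :> R by rewrite mulr_ge0 ?expR_ge0.
rewrite [leRHS]exprS (le_trans _ (ler_wpM2l e0 IH))//.
have l0 : 0 <= d%:R / 8 :> R by rewrite divr_ge0.
have [bG bF GF] := stein_restr mu_unif measurable_gauss gauss_ge0 gauss_le iE Ed1
  (test_fun_gauss l0).
set F := (X in bmf X) in bF; set G := (X in bmf X) in bG.
have bD : bmf (restr gauss D) by exact: (bmf_restr measurable_gauss gauss_ge0 gauss_le).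
have FE x : F x = tnth x i ^+ 2 * restr gauss D x.
  by rewrite /F DE restrU1// -/f /gauss; ring.
have le1 : mean mu G <= mean mu (restr gauss D) + d%:R / 4 * mean mu F.
  rewrite -meanZ// -meanD//; last exact: bmfZ.
  apply: le_mean => //; first by apply: bmfD => //; exact: bmfZ.
  move=> x; rewrite FE /G; have [Sx|Sx] := pselect (sphere x); last first.
    by rewrite !restr_off// !mulr0 addr0.
  rewrite sum_sphere// [in leRHS]DE !restrU1// -/f -/(gauss _).
  have S0 : 0 <= \sum_(j in i |: E) tnth x j ^+ 2.
    by apply: sumr_ge0 => j _; rewrite sqr_ge0.
  have -> : gauss (tnth x i) * f x +
      d%:R / 4 * (tnth x i ^+ 2 * (gauss (tnth x i) * f x)) =
      (1 + 2 * (d%:R / 8) * tnth x i ^+ 2) * gauss (tnth x i) * f x by field.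
  apply: ler_wpM2r => //; rewrite ler_piMr//; last by rewrite lerBlDr lerDl.
  by rewrite mulr_ge0// addr_ge0// mulr_ge0 ?sqr_ge0// mulr_ge0.
have le2 : mean mu (restr gauss D) <= expR 1 * mean mu f + d%:R / 8 * mean mu F.
  rewrite -!meanZ// -meanD//; [|exact: bmfZ|exact: bmfZ].
  apply: le_mean => //; first by apply: bmfD; exact: bmfZ.
  move=> x; rewrite FE {1 2}DE !restrU1// -/f /gauss.
  set u := d%:R / 8 * tnth x i ^+ 2.
  have u0 : 0 <= u by rewrite mulr_ge0 ?sqr_ge0.
  rewrite (_ : _ + _ = (expR 1 + u * expR u) * f x); last by rewrite /u; ring.
  apply: ler_wpM2r => //.
  have [u1|u1] := leP u 1.
    by rewrite (@le_trans _ _ (expR 1)) ?ler_expR// lerDl mulr_ge0// expR_ge0.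
  by rewrite (@le_trans _ _ (u * expR u)) ?ler_peMl ?lerDr ?expR_ge0// ltW.
have F0 : 0 <= mean mu F.
  by apply: mean_ge0 => x; rewrite FE mulr_ge0 ?sqr_ge0 ?restr_ge0.
have le3 : 3 / 4 * d%:R * mean mu F <= mean mu G.
  rewrite GF ler_wpM2r// natrB ?(ltnW Ed1)//.
  have : (#|E|.+1)%:R * 4 <= d%:R :> R by rewrite Ek -natrM ler_nat.
  by move=> h; lra.
have f1 : 0 <= expR 1 * mean mu f by rewrite mulr_ge0 ?expR_ge0// mean_ge0.
move: le1 le2 le3 F0 f1; move: (mean mu G) (mean mu F) (mean mu f) (mean mu (restr gauss D)).
move=> g b m a; move: (expR 1) => e; move: (d%:R : R) => D1.
move=> h1 h2 h3 h4 h5.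
have : D1 * b <= 2 * a by lra.
have : D1 / 8 * b = (D1 * b) / 8 by ring.
move=> h6 h7; rewrite -mulrA; lra.
Qed.

(** Exponential Markov inequality with the weight [d/8]. *)
Lemma tail_bound D (q : R) : (#|D| * 4 <= d)%N ->
  mean mu \1_[set x : d.-tuple R | q < \sum_(l in D) tnth x l ^+ 2] <=
  (2 * expR 1) ^+ #|D| * expR (- (d%:R / 8 * q)).
Proof.
move=> Dd.
have mA : measurable [set x : d.-tuple R | q < \sum_(l in D) tnth x l ^+ 2].
  rewrite -[X in measurable X]setTI.
  apply: measurable_fun_ltr => //.
  rewrite (_ : (fun x => _) = fun x => \sum_(l <- enum D) tnth x l ^+ 2).
    by apply: measurable_sum => l; apply: measurable_funX; exact: measurable_tnth.
  by apply/funext => x; rewrite big_enum.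
have bR := bmf_restr measurable_gauss gauss_ge0 gauss_le D.
rewrite -(mean_sphere mu_unif); last exact: bmf_ind.
apply: (@le_trans _ _ (expR (- (d%:R / 8 * q)) * mean mu (restr gauss D))); last first.
  by rewrite mulrC ler_wpM2r ?expR_ge0// gaussian_moment.
rewrite -meanZ//; apply: le_mean.
- by apply: bmfM; [exact: bmf_sphere|exact: bmf_ind].
- exact: bmfZ.
move=> x; have [Sx|Sx] := pselect (sphere x); last first.
  by rewrite restr_off// indicE memNset// mul0r mulr0.
rewrite !indicE (mem_set Sx) mul1r.
have [|_] := boolP (x \in _); last by rewrite mulr_ge0 ?expR_ge0// restr_ge0.
move/set_mem => /= qx; rewrite restr_on// /gauss -expR_sum -expRD.
rewrite -expR0 ler_expR -mulr_sumr addrC subr_ge0 ler_wpM2l//.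
exact: ltW.
Qed.

End Tail.

(** * Orthonormal frames in place of coordinate axes *)

Section Completion.
Context {R : realType} {d : nat}.
Implicit Types (D : {set 'I_d}) (e : 'I_d -> 'I_d -> R).

(** Induction on [#|D|]. A matrix with the right rows over [D :\ i] is multiplied on the left by the
    Householder reflection exchanging [b], the coordinates of [e i] in its rows, with the [i]-th
    basis vector. For [l] in [D :\ i] the entry [b l] is [<e l, e i> = 0], so these rows stay
    put. *)
Lemma orthogonal_completion D e :
  {in D &, forall l m, dot (e l) (e m) = (l == m)%:R} ->
  exists Q : 'M[R]_d, Q *m Q^T = 1%:M /\ {in D, forall l j, Q l j = e l j}.
Proof.
move: {2}#|D| (erefl #|D|) => k; elim: k D => [|k IH] D.
  move/eqP; rewrite cards_eq0 => /eqP-> _; exists 1%:M.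
  by rewrite trmx1 mulmx1; split => // l; rewrite inE.
move=> Dk orth; have /set0Pn[i iD] : D != finset.set0 by rewrite -card_gt0 Dk.
have Ek : #|D :\ i| = k by move: Dk; rewrite (cardsD1 i) iD => -[].
have [|Q [QQ Qe]] := IH _ Ek.
  by move=> l m /setD1P[_ lD] /setD1P[_ mD]; exact: orth.
have QtQ : Q^T *m Q = 1%:M by exact: mulmx1C.
have colQ j l : \sum_m Q m j * Q m l = (j == l)%:R.
  have /matrixP/(_ j l) := QtQ; rewrite !mxE => <-.
  by apply: eq_bigr => m _; rewrite mxE.
pose b l := dot (Q l) (e i).
have bb : dot b b = 1.
  transitivity (\sum_l \sum_j b l * (Q l j * e i j)).
    by apply: eq_bigr => l _; rewrite -mulr_sumr.
  rewrite exchange_big/= -[RHS](_ : dot (e i) (e i) = 1); last by rewrite orth ?eqxx.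
  apply: eq_bigr => j _.
  rewrite (eq_bigr (fun l => e i j * (Q l j * b l))); last by move=> l _; ring.
  rewrite -mulr_sumr; congr (_ * _).
  transitivity (\sum_l \sum_m e i m * (Q l j * Q l m)).
    by apply: eq_bigr => l _; rewrite mulr_sumr; apply: eq_bigr => m _; ring.
  rewrite exchange_big/= -[RHS](sum_delta j); apply: eq_bigr => m _.
  by rewrite -mulr_sumr colQ mulrC.
have bQ j : \sum_m Q m j * b m = e i j.
  rewrite -[RHS](sum_delta j).
  transitivity (\sum_m \sum_l e i l * (Q m j * Q m l)).
    by apply: eq_bigr => l _; rewrite mulr_sumr; apply: eq_bigr => m _; ring.
  rewrite exchange_big/=; apply: eq_bigr => m _.
  by rewrite -mulr_sumr colQ mulrC.
pose w l := b l - (l == i)%:R.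
have dotd (a : 'I_d -> R) : dot a (fun l => (l == i)%:R) = a i.
  by rewrite dotC -[RHS](sum_delta i); apply: eq_bigr => l _; rewrite eq_sym.
exists (householder w *m Q); split.
  by rewrite trmx_mul mulmxA -[_ *m Q *m _]mulmxA QQ mulmx1 householder_orth.
move=> l lD j.
rewrite mxE (householder_row w l (fun m => Q m j)).
have [li|li] := eqVneq l i; last first.
  have lE : l \in D :\ i by rewrite !inE li.
  have -> : w l = 0.
    rewrite /w (negPf li) subr0 /b.
    transitivity (dot (e l) (e i)); first by apply: eq_bigr => m _; rewrite Qe.
    by rewrite orth// (negPf li).
  by rewrite mulr0 subr0 Qe.
have aw : dot (fun m => Q m j) w = e i j - Q i j by rewrite dotBr dotd -bQ.
have ww : dot w w = 2 * (1 - b i).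
  by rewrite [LHS]dotBr dotd (dotC w) [X in X - _]dotBr dotd bb /w eqxx /=; ring.
have wi : w i = - (1 - b i) by rewrite /w eqxx /=; ring.
rewrite li aw ww wi.
(* If [b i = 1] then [w = 0], the reflection is the identity, and row [i] is already [e i]. *)
have [b0|b0] := eqVneq (1 - b i) 0; last by field.
have : dot (fun m => Q m j) w = 0.
  by rewrite /dot big1// => m _; rewrite (dot_eq0 (a := w)) ?mulr0// ww b0 mulr0.
rewrite aw b0 => /eqP; rewrite subr_eq0 => /eqP ->; ring.
Qed.

Variable mu : probability (d.-tuple R) R.
Hypothesis mu_unif : uniform_on_sphere mu.

(** Completing the family to an orthogonal matrix turns its coordinates into standard ones. As [e]
    is arbitrary outside [D], the event may depend on the coordinates in [D] only. *)
Lemma mean_frame D e (A : set ('I_d -> R)) :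
  {in D &, forall l m, dot (e l) (e m) = (l == m)%:R} ->
  (forall a b, {in D, a =1 b} -> A a -> A b) ->
  measurable [set x : d.-tuple R | A (tnth x)] ->
  mean mu \1_[set x : d.-tuple R | A (fun l => dot (tnth x) (e l))] =
  mean mu \1_[set x : d.-tuple R | A (tnth x)].
Proof.
move=> orth AD mA; have [Q [QQ Qe]] := orthogonal_completion orth.
rewrite -[RHS](mean_orth mu_unif QQ (@measurable_mulmx_tuple _ _ Q)); last exact: bmf_ind.
apply: eq_mean => x /=; rewrite !indicE; congr (nat_of_bool _)%:R.
have xQ : {in D, tnth (mulmx_tuple Q x) =1 fun l => dot (tnth x) (e l)}.
  move=> l lD; rewrite tnth_mktuple.
  by apply: eq_bigr => j _; rewrite Qe// mulrC.
apply/idP/idP => /set_mem/= h; apply/mem_set => /=; move: h; apply: AD => // l lD.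
by rewrite xQ.
Qed.

Lemma measurable_dot_ball D e (t : R) :
  measurable [set x : d.-tuple R | {in D, forall l, dot (tnth x) (e l) ^+ 2 <= t ^+ 2}].
Proof.
rewrite (_ : [set x | _] = \bigcap_(l in [set` D])
    [set x : d.-tuple R | dot (tnth x) (e l) ^+ 2 <= t ^+ 2]) //.
apply: fin_bigcap_measurable => // l _.
rewrite -[X in measurable X]setTI.
apply: measurable_fun_ler => //; apply: measurable_funX; apply: measurable_sum => i.
by apply: measurable_funM => //; exact: measurable_tnth.
Qed.

Lemma small_ball_frame D e (t : R) : 0 < t -> (#|D|.*2 <= d)%N ->
  #|D|%:R * t ^+ 2 <= 1 / 2 ->
  {in D &, forall l m, dot (e l) (e m) = (l == m)%:R} ->
  mean mu \1_[set x : d.-tuple R | {in D, forall l, dot (tnth x) (e l) ^+ 2 <= t ^+ 2}] <=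
  (12 * t * Num.sqrt d%:R) ^+ #|D|.
Proof.
move=> t0 Dd Dt orth.
pose A (a : 'I_d -> R) := {in D, forall l, a l ^+ 2 <= t ^+ 2}.
have AE (x : d.-tuple R) : \prod_(l in D) ((tnth x l ^+ 2 <= t ^+ 2)%R%:R : R) =
    \1_[set x : d.-tuple R | A (tnth x)] x.
  rewrite indicE; have [/set_mem/= Ax|Ax] := boolP (_ \in _).
    by rewrite big1// => l lD; rewrite Ax.
  have [->|/prodf_neq0 h] := eqVneq (\prod_(l in D) ((tnth x l ^+ 2 <= t ^+ 2)%R%:R : R)) 0.
    by [].
  exfalso; move/negP: Ax; apply; apply/mem_set => l lD /=.
  by have := h l lD; case: (_ <= _); rewrite ?eqxx.
have mA : measurable [set x : d.-tuple R | A (tnth x)].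
  rewrite (_ : [set x | _] = \bigcap_(l in [set` D]) [set x : d.-tuple R | tnth x l ^+ 2 <= t ^+ 2]) //.
  apply: fin_bigcap_measurable => // l _.
  rewrite -[X in measurable X]setTI.
  apply: measurable_fun_ler => //; apply: measurable_funX; exact: measurable_tnth.
rewrite (mean_frame (A := A) orth)//; last by move=> a b ab aA l lD; rewrite -ab// aA.
apply: le_trans (small_ball mu_unif t0 Dd Dt).
rewrite -(mean_sphere mu_unif); last exact: bmf_ind.
rewrite le_eqVlt; apply/orP; left; apply/eqP.
by apply: eq_mean => x; rewrite /restr AE.
Qed.

Lemma tail_frame D e (q : R) : (#|D| * 4 <= d)%N ->
  {in D &, forall l m, dot (e l) (e m) = (l == m)%:R} ->
  mean mu \1_[set x : d.-tuple R | q < \sum_(l in D) dot (tnth x) (e l) ^+ 2] <=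
  (2 * expR 1) ^+ #|D| * expR (- (d%:R / 8 * q)).
Proof.
move=> Dd orth.
rewrite (mean_frame (A := fun a => q < \sum_(l in D) a l ^+ 2) orth).
- exact: tail_bound.
- by move=> a b ab; rewrite (eq_bigr (fun l => b l ^+ 2))// => l lD; rewrite ab.
- rewrite -[X in measurable X]setTI.
  apply: measurable_fun_ltr => //.
  rewrite (_ : (fun x => _) = fun x => \sum_(l <- enum D) tnth x l ^+ 2).
    by apply: measurable_sum => l; apply: measurable_funX; exact: measurable_tnth.
  by apply/funext => x; rewrite big_enum.
Qed.

End Completion.

(** * Independent vectors *)

Section Resample.
Context {R : realType} {disp : measure_display} {T : measurableType disp} {n : nat}.
Variable L : probability (n.-tuple T) R.
Variable nu : 'I_n -> probability T R.
Hypothesis L_prod : forall A : 'I_n -> set T, (forall i, measurable (A i)) ->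
  L [set X | forall i, A i (tnth X i)] = (\prod_(i < n) nu i (A i))%E.

Definition upd (i : 'I_n) (X : n.-tuple T) (x : T) : n.-tuple T :=
  [tuple if j == i then x else tnth X j | j < n].

Lemma tnth_upd i X x j : tnth (upd i X x) j = if j == i then x else tnth X j.
Proof. by rewrite tnth_mktuple. Qed.

Lemma measurable_upd i : measurable_fun setT (fun Xx => upd i Xx.1 Xx.2).
Proof.
apply/measurable_fun_tnthP => j /=.
rewrite (_ : _ \o _ = fun Xx => if j == i then Xx.2 else tnth Xx.1 j); last first.
  by apply/funext => Xx /=; rewrite tnth_upd.
case: eqP => _; first exact: measurable_snd.
exact: (measurableT_comp (measurable_tnth j) measurable_fst).
Qed.

Lemma measurable_upd2 i X : measurable_fun setT (upd i X).
Proof.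
apply/measurable_fun_tnthP => j /=.
rewrite (_ : _ \o _ = fun x => if j == i then x else tnth X j); last first.
  by apply/funext => x /=; rewrite tnth_upd.
by case: eqP.
Qed.

Definition box (A : 'I_n -> set T) : set (n.-tuple T) :=
  [set X | forall i, A i (tnth X i)].

Lemma measurable_box A : (forall i, measurable (A i)) -> measurable (box A).
Proof.
move=> mA.
have -> : box A = \bigcap_(i in setT) ((@tnth n T)^~ i @^-1` A i).
  by apply/seteqP; split=> X h i; [move=> _; exact: h|exact: (h i I)].
apply: fin_bigcap_measurable; first exact: finite_finset.
move=> i _; rewrite -[X in measurable X]setTI.
exact: measurable_tnth.
Qed.

Let boxes : set (set (n.-tuple T)) :=
  [set B | exists2 A, forall i, measurable (A i) & B = box A].

Let boxes_gen : measurable = <<s boxes >> :> set (set (n.-tuple T)).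
Proof.
apply/seteqP; split.
  apply: smallest_sub; first exact: smallest_sigma_algebra.
  rewrite (_ : \big[setU/set0]_(i < n) _ =
    \bigcup_(i in setT) preimage_set_system setT ((@tnth n T)^~ i) measurable).
    move=> _ [i _ [A mA <-]]; apply: sub_sigma_algebra.
    exists (fun j => if j == i then A else setT); first by move=> j; case: eqP.
    apply/seteqP; split=> X /=.
      by move=> [_ AX] j; case: eqP => // ->.
    by move=> /(_ i); rewrite eqxx.
  apply/seteqP; split.
    move=> B; rewrite -bigcup_seq => -[i _ h]; by exists i.
  by move=> B [i _ h]; rewrite -bigcup_seq; exists i => //=; rewrite mem_index_enum.
apply: smallest_sub; first exact: sigma_algebra_measurable.
by move=> _ [A mA ->]; exact: measurable_box.
Qed.

Let boxes_setI : setI_closed boxes.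
Proof.
move=> _ _ [A mA ->] [B mB ->]; exists (fun i => A i `&` B i).
  by move=> i; exact: measurableI.
apply/seteqP; split=> X; first by move=> [a b] i; split; [exact: a|exact: b].
by move=> h; split => i; have [] := h i.
Qed.

(** Both sides are probabilities that agree on boxes, which are stable under intersection and
    generate the sigma-algebra. *)
Lemma resample_measure i (B : set (n.-tuple T)) : measurable B ->
  L B = (L \x nu i)%E ((fun Xx => upd i Xx.1 Xx.2) @^-1` B).
Proof.
move=> mB.
pose g := fun Xx : n.-tuple T * T => upd i Xx.1 Xx.2.
have mg : measurable_fun setT g by exact: measurable_upd.
pose m : {measure set (n.-tuple T) -> \bar R} :=
  measure_function_pushforward__canonical__measure_function_Measure (L \x nu i)%E mg.
have nuT j : nu j setT = 1%E by exact: probability_setT.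
suff : L B = m B by [].
apply: (measure_unique boxes (fun=> setT) boxes_gen boxes_setI) => //.
- move=> _; exists (fun=> setT) => //.
  by apply/seteqP; split.
- by rewrite bigcup_const.
- move=> _ [A mA ->].
  rewrite /m /= /pushforward (_ : g @^-1` box A =
     box (fun j => if j == i then setT else A j) `*` A i); last first.
    apply/seteqP; split=> -[X x] /=.
      move=> h; split; last by have := h i; rewrite tnth_upd eqxx.
      by move=> j; case: eqP => // /eqP ji; have := h j; rewrite tnth_upd (negPf ji).
    move=> [h Ax] j; rewrite tnth_upd; case: eqP => [->//|/eqP ji].
    by have := h j; rewrite (negPf ji).
  have mA' j : measurable (if j == i then setT else A j) by case: ifP.
  rewrite (_ : (L \x nu i)%E _ =
      (L (box (fun j => if j == i then setT else A j)) * nu i (A i))%E); last first.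
    by apply: product_measure1E => //; exact: measurable_box.
  have Lbox C : (forall j, measurable (C j)) -> L (box C) = (\prod_(j < n) nu j (C j))%E.
    exact: L_prod.
  rewrite !Lbox// (bigD1 i)//= [X in _ = (X * _)%E](bigD1 i)//= eqxx nuT mul1e muleC.
  by congr (_ * _)%E; apply: eq_bigr => j ji; rewrite (negPf ji).
- by move=> _; rewrite (_ : _ setT = 1%E) ?ltry//; exact: probability_setT.
Qed.

(** Fubini, in the role of conditioning on all vectors but the [i]-th: in the inner mean [X] is
    frozen and only [x] is random. *)
Lemma mean_resample i (f : n.-tuple T -> R) : bmf f ->
  bmf (fun X => mean (nu i) (fun x => f (upd i X x))) /\
  mean L f = mean L (fun X => mean (nu i) (fun x => f (upd i X x))).
Proof.
move=> bf; have [mf [M fM]] := bf.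
pose g := fun Xx : n.-tuple T * T => upd i Xx.1 Xx.2.
have mg : measurable_fun setT g by exact: measurable_upd.
have bfu X : bmf (fun x => f (upd i X x)).
  exact: (bmf_comp (measurable_upd2 i X) bf).
have intf : (L \x nu i)%E.-integrable setT (EFin \o (f \o g)).
  apply: measurable_bounded_integrable => //.
  - apply: (@le_lt_trans _ _ (L setT * nu i setT)%E).
      by rewrite -(product_measure1E L (nu i))// setXTT.
    have LT : L setT = 1%E by exact: probability_setT.
    have nT : nu i setT = 1%E by exact: probability_setT.
    by rewrite LT nT mule1 ltry.
  - exact: measurableT_comp.
  - exists M; split; first exact: num_real.
    by move=> x Mx y _ /=; apply: (le_trans (fM _)); exact: ltW.
have FE X : (\int[nu i]_x (f (g (X, x)))%:E)%E = (mean (nu i) (fun x => f (upd i X x)))%:E.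
  exact: mean_integral (bfu X).
have bF : bmf (fun X => mean (nu i) (fun x => f (upd i X x))).
  split.
    apply/measurable_EFinP.
    rewrite (_ : _ \o _ = fubini_F (nu i) (EFin \o (f \o g))); last first.
      by apply/funext => X /=; rewrite -FE.
    exact: (measurable_fubini_F intf).
  exists M => X; rewrite -[leRHS](mean_cst (nu i)).
  by apply: mean_norm_le => //; exact: bmf_cst.
split=> //; apply: EFin_inj; rewrite -!mean_integral//.
transitivity (\int[pushforward (L \x nu i)%E g]_X (f X)%:E)%E.
  by apply: eq_measure_integral => A mA _; exact: resample_measure.
rewrite (@integral_pushforward _ _ _ _ _ g)//; last exact/measurable_EFinP.
rewrite preimage_setT.
transitivity (\int[L]_X \int[nu i]_x (f (g (X, x)))%:E)%E; last first.
  by apply: eq_integral => X _; exact: FE.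
by rewrite (integral12_prod_meas1 intf).
Qed.

End Resample.

(** * Gram-Schmidt coordinates *)

Section GramSchmidt.
Context {R : realType} {d : nat}.
Local Notation vec := ('I_d -> R).
Implicit Types (x : nat -> vec) (y z w : vec) (u v l m : nat).

(* Gram-Schmidt without normalisation. When [gs x l] vanishes, i.e. [x l] depends
   linearly on its predecessors, division by [0] yields [0] and step [l] does
   nothing. *)
Fixpoint res x v y : vec :=
  if v is v'.+1 then
    let r := res x v' (x v') in
    fun i => res x v' y i - dot (res x v' y) r / dot r r * r i
  else y.

Definition gs x v : vec := res x v (x v).

(** In the coordinates [z_uv], away from degenerate steps, [gs x v] is [z_vv] times a unit vector,
    so [coeff x (x u) v] is [z_uv * z_vv] and [rho x v] is [z_vv^2], while [proj2 x v y] is the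
    squared norm of the projection of [y] on the span of the first [v] vectors. *)
Definition coeff x y l : R := dot y (gs x l).

Definition rho x l : R := dot (gs x l) (gs x l).

Definition proj2 x v y : R := \sum_(l < v) coeff x y l ^+ 2 / rho x l.

Lemma resS x v y : res x v.+1 y =
  fun i => res x v y i - dot (res x v y) (gs x v) / rho x v * gs x v i.
Proof. by []. Qed.

Lemma rho_ge0 x l : 0 <= rho x l. Proof. exact: dot_ge0. Qed.

Lemma dot_rho0 x l y : rho x l = 0 -> dot y (gs x l) = 0.
Proof. by move=> r0; apply: big1 => i _; rewrite (dot_eq0 r0) mulr0. Qed.

Lemma eq_res x x' v y : (forall l, (l < v)%N -> x l = x' l) ->
  res x v y = res x' v y.
Proof.
elim: v y => [//|v IH] y xx'.
have IHv z : res x v z = res x' v z by apply: IH => l lv; apply: xx'; exact: ltnW.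
by rewrite !resS /rho /gs !IHv xx'.
Qed.

Lemma eq_gs x x' v : (forall l, (l <= v)%N -> x l = x' l) -> gs x v = gs x' v.
Proof.
move=> xx'; rewrite /gs xx'//; apply: eq_res => l lv; apply: xx'; exact: ltnW.
Qed.

Lemma res_orth x v l y : (l < v)%N -> dot (res x v y) (gs x l) = 0.
Proof.
elim: v l y => [//|v IH] l y; rewrite ltnS leq_eqVlt => /predU1P[->|lv].
  rewrite resS dotBl dotZl; have [r0|r0] := eqVneq (rho x v) 0.
    by rewrite -/(rho x v) r0 mulr0 subr0 dot_rho0.
  by rewrite -/(rho x v) divfK// subrr.
have vl0 : dot (gs x v) (gs x l) = 0 by exact: IH.
by rewrite resS dotBl dotZl vl0 IH// mulr0 subrr.
Qed.

Lemma gs_orth x v l : v != l -> dot (gs x v) (gs x l) = 0.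
Proof.
by case: (ltngtP v l) => // [vl|lv] _; [rewrite dotC|]; exact: res_orth.
Qed.

Lemma res_expand x v y i :
  y i = res x v y i + \sum_(l < v) dot (res x l y) (gs x l) / rho x l * gs x l i.
Proof.
elim: v => [|v IH]; first by rewrite big_ord0 addr0.
by rewrite big_ord_recr/= -/(gs x v) -/(rho x v) {1}IH; ring.
Qed.

(** [y] differs from its residue by a combination of earlier directions, to which the residue of [z]
    is orthogonal. *)
Lemma dot_res x v y z : dot y (res x v z) = dot (res x v y) (res x v z).
Proof.
rewrite {1}/dot; under eq_bigr do rewrite (res_expand x v y) mulrDl mulr_suml.
rewrite big_split/= -/(dot _ _) -[RHS]addr0; congr (_ + _).
rewrite exchange_big/= big1// => l _.
under eq_bigr do rewrite -mulrA.
have h : dot (gs x l) (res x v z) = 0 by rewrite dotC res_orth.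
by rewrite -mulr_sumr [X in _ * X]h mulr0.
Qed.

Lemma coeffE x y l : coeff x y l = dot (res x l y) (gs x l).
Proof. exact: dot_res. Qed.

Lemma dot_expand x v y z : dot y z =
  dot (res x v y) (res x v z) + \sum_(l < v) coeff x y l * coeff x z l / rho x l.
Proof.
rewrite -dot_res dotC [in RHS]dotC.
rewrite {1}/dot; under eq_bigr do rewrite (res_expand x v z) mulrDl mulr_suml.
rewrite big_split/= -/(dot _ _); congr (_ + _).
rewrite exchange_big/=; apply: eq_bigr => l _.
under eq_bigr do rewrite -mulrA.
have h : \sum_i gs x l i * y i = coeff x y l by rewrite -/(dot _ _) dotC.
by rewrite -mulr_sumr -coeffE h; ring.
Qed.

Lemma proj2E x v y : proj2 x v y = dot y y - dot (res x v y) (res x v y).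
Proof.
rewrite (dot_expand x v y y) addrC addKr.
by apply: eq_bigr => l _; rewrite expr2.
Qed.

Lemma proj2_ge0 x v y : 0 <= proj2 x v y.
Proof. by apply: sumr_ge0 => l _; rewrite divr_ge0 ?sqr_ge0 ?rho_ge0. Qed.

Lemma proj2_mono x v u y : (v <= u)%N -> proj2 x v y <= proj2 x u y.
Proof.
move=> vu; rewrite /proj2 (big_ord_widen _ (fun l => coeff x y l ^+ 2 / rho x l) vu).
rewrite [leRHS](bigID (fun l : 'I_u => (l < v)%N))/= lerDl.
by apply: sumr_ge0 => l _; rewrite divr_ge0 ?sqr_ge0 ?rho_ge0.
Qed.

Lemma rhoE x v : rho x v = dot (x v) (x v) - proj2 x v (x v).
Proof. by rewrite proj2E opprB addrC subrK. Qed.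

Lemma dot_coeff x u v : dot (x u) (x v) =
  coeff x (x u) v + \sum_(l < v) coeff x (x u) l * coeff x (x v) l / rho x l.
Proof. by rewrite (dot_expand x v (x u)) -coeffE. Qed.

(** Discriminant argument: the sum of [(B a_i - S b_i)^2 / c_i] equals [B (A B - S^2)]. Weights may
    vanish, division by 0 discarding their terms; this accommodates degenerate Gram-Schmidt
    steps. *)
Lemma weighted_cauchy_schwarz n (a b c : 'I_n -> R) : (forall i, 0 <= c i) ->
  (\sum_i a i * b i / c i) ^+ 2 <= (\sum_i a i ^+ 2 / c i) * (\sum_i b i ^+ 2 / c i).
Proof.
move=> c0; set S := \sum_i a i * _ / _; set A := \sum_i a i ^+ 2 / _.
set B := \sum_i b i ^+ 2 / _.
have B0 : 0 <= B by apply: sumr_ge0 => i _; rewrite divr_ge0 ?sqr_ge0.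
have : 0 <= \sum_i (B * a i - S * b i) ^+ 2 / c i.
  by apply: sumr_ge0 => i _; rewrite divr_ge0 ?sqr_ge0.
rewrite (_ : \sum_i _ = B ^+ 2 * A - (2 * (B * S)) * S + S ^+ 2 * B); last first.
  transitivity (\sum_i (B ^+ 2 * (a i ^+ 2 / c i) - 2 * (B * S) * (a i * b i / c i) +
      S ^+ 2 * (b i ^+ 2 / c i))); first by apply: eq_bigr => i _; ring.
  by rewrite big_split sumrB /= -!mulr_sumr.
have [Bz _|Bnz] := eqVneq B 0.
  suff -> : S = 0 by rewrite expr0n/= Bz mulr0.
  apply: big1 => i _; move/eqP: Bz; rewrite psumr_eq0; last first.
    by move=> j _; rewrite divr_ge0 ?sqr_ge0.
  move=> /allP h; have := h i (mem_index_enum _).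
  rewrite /= mulf_eq0 expf_eq0/= => /orP[/eqP->|/eqP->]; first by rewrite mulr0 mul0r.
  by rewrite mulr0.
rewrite (_ : _ + _ = B * (A * B - S ^+ 2)); last by ring.
by rewrite pmulr_rge0 ?subr_ge0// lt_def Bnz.
Qed.

(** The inequality is not strict: a non-fragile edge then has a nonzero main term, and reversing
    that term negates [0 <= dot] with no case of equality. *)
Definition fragile x u v : bool :=
  coeff x (x u) v ^+ 2 <= proj2 x v (x u) * proj2 x v (x v).

Lemma sign_nonfragile x u v : ~~ fragile x u v ->
  (0 <= dot (x u) (x v)) = (0 < coeff x (x u) v) /\ coeff x (x u) v != 0.
Proof.
rewrite -ltNge => nf; rewrite dot_coeff; set a := coeff _ _ v in nf *.
set s := \sum_(_ < _) _.
have sa : s ^+ 2 < a ^+ 2.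
  by apply: le_lt_trans nf; apply: weighted_cauchy_schwarz => l; exact: rho_ge0.
have {}sa : `|s| < `|a| by rewrite -(@ltr_pXn2r _ 2)// ?nnegrE// -!normrX !ger0_norm ?sqr_ge0.
have a0 : a != 0 by rewrite -normr_gt0 (le_lt_trans _ sa).
split=> //; move: sa; rewrite ltr_norml; case: (ltgtP a 0) a0 => // [a0|a0] _.
  rewrite ltr0_norm// opprK => /andP[s1 s2].
  by apply/negbTE; rewrite -ltNge; lra.
by rewrite gtr0_norm// => /andP[s1 s2]; lra.
Qed.

Definition frame x l : vec := fun i => (Num.sqrt (rho x l))^-1 * gs x l i.

Lemma frame_orth x l m : rho x l != 0 -> rho x m != 0 ->
  dot (frame x l) (frame x m) = (l == m)%:R.
Proof.
move=> l0 m0; rewrite dotZl dotZr.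
have [<-|lm] := eqVneq l m; last by rewrite gs_orth// !mulr0.
have rl : 0 < rho x l by rewrite lt_def l0 rho_ge0.
rewrite -/(rho x l) -{3}(sqr_sqrtr (ltW rl)) /=.
by field; rewrite gt_eqF// sqrtr_gt0.
Qed.

Lemma dot_frame x l y : dot y (frame x l) ^+ 2 = coeff x y l ^+ 2 / rho x l.
Proof.
rewrite dotZr exprMn exprVn sqr_sqrtr ?rho_ge0// mulrC; congr (_ / _).
Qed.

(** Pythagoras: the projection of [gs x v] on the first [l] directions already has its full norm.
    Hence adding a multiple of [gs x v] to a later vector does not change its residue. *)
Lemma res_gs0 x v l : (v < l)%N -> forall i, res x l (gs x v) i = 0.
Proof.
move=> vl; apply: dot_eq0; apply/eqP; rewrite -[_ == _]negbK.
have := proj2E x l (gs x v); rewrite -/(rho x v).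
have -> : proj2 x l (gs x v) = rho x v.
  rewrite /proj2 (bigD1 (Ordinal vl))//= /coeff -/(rho x v) big1 ?addr0.
    by have [->|r0] := eqVneq (rho x v) 0; [rewrite expr0n/= mul0r|rewrite expr2 mulfK].
  by move=> m; rewrite -val_eqE/= eq_sym => /gs_orth ->; rewrite expr0n/= mul0r.
by move/eqP; rewrite eq_sym subr_eq addrC -subr_eq subrr eq_sym negbK.
Qed.

Lemma res_lin x v (c : R) y z :
  res x v (fun i => y i - c * z i) = fun i => res x v y i - c * res x v z i.
Proof.
elim: v => [//|v IH].
by apply/funext => i; rewrite !resS IH dotBl dotZl; ring.
Qed.

Definition reflv w y : vec := fun i => y i - 2 * (dot y w / dot w w) * w i.

(** * Effect of a reflection on the Gram-Schmidt coordinates *)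

Section Flip.
Variables (x : nat -> vec) (v : nat) (C : pred nat).
Hypothesis C_gt : forall u, C u -> (v < u)%N.

Definition flip u : vec := if C u then reflv (gs x v) (x u) else x u.

(** A reflected vector has a label above [v] and differs from the original by a multiple of
    [gs x v], which its residue forgets; so the Gram-Schmidt directions are those of [x]. *)
Lemma res_flip l y : res flip l y = res x l y.
Proof.
elim/ltn_ind: l y => l IH y.
case: l IH => [//|l] IH; rewrite !resS.
have gsE : gs flip l = gs x l.
  rewrite /gs IH// /flip; case: ifP => // /C_gt vl.
  by rewrite res_lin; apply/funext => i; rewrite res_gs0// mulr0 subr0.
by rewrite /rho gsE IH.
Qed.

Lemma gs_flip l : gs flip l = gs x l.
Proof.
rewrite /gs res_flip /flip; case: ifP => // /C_gt vl.
by rewrite res_lin; apply/funext => i; rewrite res_gs0// mulr0 subr0.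
Qed.

Lemma coeff_flip u l : coeff flip (flip u) l =
  if C u && (l == v) then - coeff x (x u) l else coeff x (x u) l.
Proof.
rewrite /coeff gs_flip /flip; case: ifP => //= Cu; rewrite /reflv dotBl dotZl.
have [->|lv] := eqVneq l v; last by rewrite (@gs_orth x v l) 1?eq_sym// mulr0 subr0.
rewrite -/(rho x v); have [r0|r0] := eqVneq (rho x v) 0.
  by rewrite dot_rho0// !(mul0r, mulr0) subr0 oppr0.
by field.
Qed.

Lemma rho_flip l : rho flip l = rho x l.
Proof. by rewrite /rho gs_flip. Qed.

Lemma coeff2_flip u l : coeff flip (flip u) l ^+ 2 = coeff x (x u) l ^+ 2.
Proof. by rewrite coeff_flip; case: ifP => // _; rewrite sqrrN. Qed.

Lemma proj2_flip l u : proj2 flip l (flip u) = proj2 x l (x u).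
Proof. by apply: eq_bigr => m _; rewrite coeff2_flip rho_flip. Qed.

Lemma fragile_flip u l : fragile flip u l = fragile x u l.
Proof. by rewrite /fragile coeff2_flip !proj2_flip. Qed.

Lemma dot_flip2 u l : C u = C l -> dot (flip u) (flip l) = dot (x u) (x l).
Proof.
rewrite /flip; case: ifP => Cu <- //; set w := gs x v; clearbody w.
rewrite /reflv dotBl !dotZl !dotBr !dotZr.
have [w0|w0] := eqVneq (dot w w) 0.
  by rewrite w0 invr0 !(mulr0, mul0r) !subr0.
by rewrite (dotC w (x l)); field.
Qed.

(** Only coefficients at [v] change. For [l < v] the expansion of the inner product stops before
    [v]; for [l > v] the edge is not fragile, and its sign is that of the coefficient at [l]. *)
Lemma sign_flip_in u l : (l < u)%N -> C u != C l -> l != v ->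
  ~~ ((v < l)%N && fragile x u l) ->
  (0 <= dot (flip u) (flip l)) = (0 <= dot (x u) (x l)).
Proof.
move=> lu Cul lv; case: (ltnP v l) => [vl /= nf|lv' _].
  have nf' : ~~ fragile flip u l by rewrite fragile_flip.
  have [-> _] := sign_nonfragile nf; have [-> _] := sign_nonfragile nf'.
  by rewrite coeff_flip (negPf lv) andbF.
have {}lv : (l < v)%N by rewrite ltn_neqAle lv.
rewrite (dot_coeff flip) (dot_coeff x) coeff_flip (ltn_eqF lv) andbF.
congr (0 <= _ + _); apply: eq_bigr => m _.
by rewrite !coeff_flip rho_flip (ltn_eqF (ltn_trans (ltn_ord m) lv)) !andbF.
Qed.

Lemma sign_flip_edge u : C u -> ~~ fragile x u v ->
  (0 <= dot (flip u) (flip v)) = ~~ (0 <= dot (x u) (x v)).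
Proof.
move=> Cu nf.
have nf' : ~~ fragile flip u v by rewrite fragile_flip.
have [-> a0] := sign_nonfragile nf; have [-> _] := sign_nonfragile nf'.
by rewrite coeff_flip Cu eqxx/= oppr_gt0 -leNgt le_eqVlt (negPf a0).
Qed.

End Flip.

End GramSchmidt.

Local Close Scope classical_set_scope.

(** * Measurability of the Gram-Schmidt data *)

Section MeasurableGramSchmidt.
Context {R : realType} {disp : measure_display} {T : measurableType disp} {d : nat}.

Lemma measurable_inv (f : T -> R) :
  measurable_fun setT f -> measurable_fun setT (fun t => (f t)^-1).
Proof.
move=> mf.
(* A real power of a nonnegative base is measurable; the identity also holds where [f] vanishes,
   both sides being 0. *)
rewrite (_ : (fun t => _) = fun t => f t * (f t ^+ 2) `^ (-1)).
  apply: measurable_funM => //.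
  exact: (measurableT_comp (measurable_powR (-1)) (measurable_funX 2 mf)).
apply/funext => t; rewrite powR_inv1 ?sqr_ge0//.
have [->|f0] := eqVneq (f t) 0; first by rewrite invr0 mul0r.
by field.
Qed.

Lemma bmf_bool (b : T -> bool) : measurable_fun setT b ->
  bmf (fun t => (b t)%:R : R).
Proof.
move=> mb; have mB : measurable [set t | b t]%classic.
  by rewrite -[X in measurable X]setTI; exact: (mb measurableT [set true]%classic).
apply: (eq_bmf (f := \1_([set t | b t]%classic))); last exact: bmf_ind.
move=> t; rewrite indicE; congr (nat_of_bool _)%:R.
by apply/idP/idP => [/set_mem//|h]; exact: mem_set.
Qed.

Lemma measurable_dot (a b : T -> 'I_d -> R) :
  (forall i, measurable_fun setT (fun t => a t i)) ->
  (forall i, measurable_fun setT (fun t => b t i)) ->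
  measurable_fun setT (fun t => dot (a t) (b t)).
Proof. by move=> ma mb; apply: measurable_sum => i; exact: measurable_funM. Qed.

Variable x : T -> nat -> 'I_d -> R.
Hypothesis mx : forall l i, measurable_fun setT (fun t => x t l i).

Lemma measurable_res v (y : T -> 'I_d -> R) i :
  (forall j, measurable_fun setT (fun t => y t j)) ->
  measurable_fun setT (fun t => res (x t) v (y t) i).
Proof.
elim: v y i => [|v IH] y i my; first exact: my.
have mr j : measurable_fun setT (fun t => gs (x t) v j) by apply: IH; exact: mx.
have my' j : measurable_fun setT (fun t => res (x t) v (y t) j) by exact: IH.
rewrite (_ : (fun t => _) = fun t => res (x t) v (y t) i -
  dot (res (x t) v (y t)) (gs (x t) v) / rho (x t) v * gs (x t) v i)//.
apply: measurable_funB => //; apply: measurable_funM => //.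
apply: measurable_funM; first exact: measurable_dot.
by apply: measurable_inv; exact: measurable_dot.
Qed.

Lemma measurable_gs v i : measurable_fun setT (fun t => gs (x t) v i).
Proof. exact: measurable_res. Qed.

Lemma measurable_rho v : measurable_fun setT (fun t => rho (x t) v).
Proof. by apply: measurable_dot => i; exact: measurable_gs. Qed.

Lemma measurable_coeff v (y : T -> 'I_d -> R) :
  (forall j, measurable_fun setT (fun t => y t j)) ->
  measurable_fun setT (fun t => coeff (x t) (y t) v).
Proof. by move=> my; apply: measurable_dot => // i; exact: measurable_gs. Qed.

Lemma measurable_proj2 v (y : T -> 'I_d -> R) :
  (forall j, measurable_fun setT (fun t => y t j)) ->
  measurable_fun setT (fun t => proj2 (x t) v (y t)).
Proof.
move=> my; apply: measurable_sum => l; apply: measurable_funM.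
  by apply: measurable_funX; exact: measurable_coeff.
by apply: measurable_inv; exact: measurable_rho.
Qed.

Lemma measurable_fragile u v : measurable_fun setT (fun t => fragile (x t) u v).
Proof.
apply: measurable_fun_ler; first by apply: measurable_funX; exact: measurable_coeff.
by apply: measurable_funM; apply: measurable_proj2.
Qed.

End MeasurableGramSchmidt.

(** * Invariance of the joint law under reflections *)

Section Reflections.
Context {R : realType} {n d : nat}.
Variable L : probability (n.-tuple (d.-tuple R)) R.
Variable nu : 'I_n -> probability (d.-tuple R) R.
Hypothesis L_prod : forall A : 'I_n -> set (d.-tuple R), (forall i, measurable (A i)) ->
  L [set X | forall i, A i (tnth X i)]%classic = (\prod_(i < n) nu i (A i))%E.
Hypothesis nu_unif : forall i, uniform_on_sphere (nu i).
Implicit Types (X : n.-tuple (d.-tuple R)) (s : seq 'I_n).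

Definition refl_seq (r : n.-tuple (d.-tuple R) -> 'I_d -> R) s X :
    n.-tuple (d.-tuple R) :=
  [tuple if i \in s then refl (r X) (tnth X i) else tnth X i | i < n].

Lemma measurable_coord (i : 'I_n) (l : 'I_d) :
  measurable_fun setT (fun X => tnth (tnth X i) l).
Proof. exact: (measurableT_comp (measurable_tnth l) (measurable_tnth i)). Qed.

Lemma measurable_refl_seq r s :
  (forall i, measurable_fun setT (fun X => r X i)) ->
  measurable_fun setT (refl_seq r s).
Proof.
move=> mr; apply/measurable_fun_tnthP => i; apply/measurable_fun_tnthP => l /=.
rewrite (_ : _ \o _ = fun X => if i \in s then
    tnth (tnth X i) l - 2 * (dot (tnth (tnth X i)) (r X) / dot (r X) (r X)) * r X l
  else tnth (tnth X i) l); last first.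
  by apply/funext => X /=; rewrite tnth_mktuple; case: ifP => // _; rewrite tnth_mktuple.
case: (i \in s); last exact: measurable_coord.
apply: measurable_funB; first exact: measurable_coord.
apply: measurable_funM => //; apply: measurable_funM => //; apply: measurable_funM.
  by apply: measurable_dot => // j; exact: measurable_coord.
by apply: measurable_inv; exact: measurable_dot.
Qed.

(** The direction [r X] ignores the vectors being reflected: resampling these one at a time, each
    inner mean sees a fixed direction and is invariant. *)
Lemma mean_refl_seq r s (f : n.-tuple (d.-tuple R) -> R) :
  (forall i, measurable_fun setT (fun X => r X i)) -> uniq s ->
  {in s, forall i X y, r (upd i X y) = r X} -> bmf f ->
  mean L (f \o refl_seq r s) = mean L f.
Proof.
move=> mr + + bf; elim: s => [|i s IH].
  move=> _ _; apply: eq_mean => X /=; congr f.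
  by apply: eq_from_tnth => j; rewrite tnth_mktuple.
move=> /= /andP[is_ us] rs.
rewrite -(IH us); last by move=> j js; apply: rs; rewrite inE js orbT.
have bs : bmf (f \o refl_seq r s) by apply: bmf_comp => //; exact: measurable_refl_seq.
have bi : bmf (f \o refl_seq r (i :: s)) by apply: bmf_comp => //; exact: measurable_refl_seq.
rewrite (mean_resample L_prod i bi).2 (mean_resample L_prod i bs).2.
apply: eq_mean => X.
have bX : bmf (fun y => (f \o refl_seq r s) (upd i X y)).
  exact: (bmf_comp (measurable_upd2 i X) bs).
rewrite -[RHS](mean_refl (nu_unif i) (r X) bX); apply: eq_mean => y /=; congr f.
have ri Z : r (upd i X Z) = r X by apply: rs; rewrite inE eqxx.
apply: eq_from_tnth => j; rewrite !tnth_mktuple !ri inE.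
by have [->|ji] := eqVneq j i; [rewrite (negPf is_)|].
Qed.

Lemma mean_off_sphere i : mean L (fun X => 1 - \1_(@sphere R d) (tnth X i)) = 0.
Proof.
have bS : bmf (fun y : d.-tuple R => 1 - \1_(@sphere R d) y : R).
  by apply: bmfB; [exact: bmf_cst|exact: bmf_sphere].
have b : bmf (fun X : n.-tuple (d.-tuple R) => 1 - \1_(@sphere R d) (tnth X i) : R).
  exact: (bmf_comp (measurable_tnth i) bS).
rewrite (mean_resample L_prod i b).2 -[RHS](mean_cst L); apply: eq_mean => X.
transitivity (mean (nu i) (fun y => 1 - \1_(@sphere R d) y)).
  by apply: eq_mean => y; rewrite tnth_upd eqxx.
rewrite -(mean_sphere (nu_unif i) bS) -[RHS](mean_cst (nu i)).
apply: eq_mean => y; rewrite indicE.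
by case: (_ \in _); rewrite ?subrr ?mulr0 ?mul0r.
Qed.

(** Reflecting the [i]-th vector along the [j]-th reverses their inner product [D], so [0 <= D] has
    probability at least 1/2. It is nested with [tau <= D], and the assumption on [tau] forces its
    probability to be exactly 1/2; nested events of equal probability differ by a null set. This
    also rules out an atom of [D] at 0. *)
Lemma mean_threshold (tau : R) (i j : 'I_n) : i != j ->
  mean L (fun X => (tau <= dotp (tnth X i) (tnth X j))%R%:R) = 1 / 2 ->
  mean L (fun X => `|(tau <= dotp (tnth X i) (tnth X j))%R%:R -
                      (0 <= dotp (tnth X i) (tnth X j))%R%:R|) = 0.
Proof.
move=> ij; set D := fun X => dotp (tnth X i) (tnth X j).
have mD : measurable_fun setT D by apply: measurable_dot => l; exact: measurable_coord.
have bge (a : R) : bmf (fun X => (a <= D X)%R%:R : R).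
  by apply: bmf_bool; exact: measurable_fun_ler.
have ble : bmf (fun X => (D X <= 0)%R%:R : R) by apply: bmf_bool; exact: measurable_fun_ler.
have sym : mean L (fun X => (D X <= 0)%R%:R) = mean L (fun X => (0 <= D X)%R%:R).
  rewrite -(@mean_refl_seq (fun X => tnth (tnth X j)) [:: i] _ _ _ _ (bge 0))//.
  - apply: eq_mean => X /=; congr (nat_of_bool _)%:R.
    rewrite /D /= -![dotp _ _]/(dot _ _) !tnth_mktuple !inE eqxx eq_sym (negPf ij).
    rewrite dot_refl; have [w0|w0] := eqVneq (dot (tnth (tnth X j)) (tnth (tnth X j))) 0.
      rewrite w0 invr0 !(mulr0, mul0r) subr0.
      suff -> : dot (tnth (tnth X i)) (tnth (tnth X j)) = 0 by [].
      by apply: big1 => l _; rewrite (dot_eq0 w0) mulr0.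
    rewrite -mulrA divfK// -subr_ge0 sub0r; congr (0 <= _); ring.
  - by move=> l; exact: measurable_coord.
  - move=> k; rewrite inE => /eqP -> X y; by rewrite tnth_upd eq_sym (negPf ij).
set b := mean L (fun X => (0 <= D X)%R%:R) in sym *.
have b2 : 1 <= b + b.
  rewrite -{1}sym -meanD// -[leLHS](mean_cst L); apply: le_mean; first exact: bmf_cst.
    exact: bmfD.
  by move=> X; case: (leP (D X) 0) => h; [rewrite lerDl|rewrite (ltW h)]; rewrite ?lerDr.
move=> taup.
(* For [tau > 0] the event [tau <= D] misses [D <= 0], of probability [b]; for [tau <= 0] it
   contains [0 <= D]. *)
have bsym : b <= 1 / 2.
  have [tau0|tau0] := ltP 0 tau.
    have : mean L (fun X => (tau <= D X)%R%:R) <= mean L (fun X => 1 - (D X <= 0)%R%:R).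
      apply: le_mean => //; first by apply: bmfB => //; exact: bmf_cst.
      move=> X; case: (leP tau (D X)) => h.
        by rewrite [D X <= 0]leNgt (lt_le_trans tau0 h) subr0.
      by rewrite subr_ge0 lern1 leq_b1.
    rewrite meanB ?mean_cst//; last exact: bmf_cst.
    by rewrite sym -/D taup; lra.
  rewrite -taup; apply: le_mean => // X.
  by case: (leP 0 (D X)) => h; [rewrite (le_trans tau0 h)|rewrite ler0n].
have bE : b = 1 / 2 by lra.
have [tau0|tau0] := ltP 0 tau.
  transitivity (mean L (fun X => (0 <= D X)%R%:R - (tau <= D X)%R%:R)).
    apply: eq_mean => X; rewrite -/(D X); case: (leP tau (D X)) => h.
      by rewrite (ltW (lt_le_trans tau0 h)) subrr normr0.
    by rewrite sub0r normrN subr0 ger0_norm.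
  by rewrite meanB// -/b bE -/D taup subrr.
transitivity (mean L (fun X => (tau <= D X)%R%:R - (0 <= D X)%R%:R)).
  apply: eq_mean => X; rewrite -/(D X) ger0_norm// subr_ge0.
  by case: (leP 0 (D X)) => h; [rewrite (le_trans tau0 h)|rewrite ler0n].
by rewrite meanB// -/b bE -/D taup subrr.
Qed.

End Reflections.

(** * Signed products over the edges of the graph *)

Section SignedEdges.
Context {R : realType} {n d : nat}.
Variables (H : graph 'I_n) (pi : {ffun 'I_n -> 'I_#|vertices H|}).
Hypothesis piH : labelling pi.
Variable z : 'I_n.
Variable L : probability (n.-tuple (d.-tuple R)) R.
Variable nu : 'I_n -> probability (d.-tuple R) R.
Hypothesis L_prod : forall A : 'I_n -> set (d.-tuple R), (forall i, measurable (A i)) ->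
  L [set X | forall i, A i (tnth X i)]%classic = (\prod_(i < n) nu i (A i))%E.
Hypothesis nu_unif : forall i, uniform_on_sphere (nu i).
Implicit Types (X : n.-tuple (d.-tuple R)) (e : {set 'I_n}) (F : {set {set 'I_n}}).
Local Notation k := #|vertices H|.
Local Notation E := (edges H).

(* The inverse of [pi]; labels outside of ['I_k] are sent to the arbitrary [z]. *)
Definition vertex_at (l : nat) : 'I_n :=
  odflt z [pick w in vertices H | (pi w == l :> nat)].

Lemma vertex_at_pi w : w \in vertices H -> vertex_at (pi w) = w.
Proof.
move=> wV; rewrite /vertex_at; case: pickP => [w' /andP[w'V /eqP/val_inj]|/(_ w)].
  exact: (pi_inj piH).
by rewrite wV eqxx.
Qed.

Lemma pi_vertex_at l : (l < k)%N ->
  vertex_at l \in vertices H /\ pi (vertex_at l) = l :> nat.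
Proof.
move=> lk; have /andP[_ /eqP/finset.setP/(_ (Ordinal lk))] := piH.
rewrite inE => /imsetP[w wV lw].
have -> : l = pi w by rewrite -lw.
by rewrite vertex_at_pi.
Qed.

Definition vec_at X (l : nat) : 'I_d -> R := tnth (tnth X (vertex_at l)).

Definition hi e : nat := pi (ends pi z e).1.
Definition lo e : nat := pi (ends pi z e).2.

Lemma lo_lt_hi e : e \in E -> (lo e < hi e < k)%N.
Proof. by move=> eE; have [_ h] := endsP piH z eE; rewrite h ltn_ord. Qed.

Lemma edge_hi_lo e : e \in E -> e = [set vertex_at (hi e); vertex_at (lo e)].
Proof.
move=> eE; have [u v] := ends_vertices piH z eE.
by rewrite !vertex_at_pi//; have [] := endsP piH z eE.
Qed.

Lemma hi_lo_edge u v : adj E u v -> (pi v < pi u)%N ->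
  hi [set u; v] = pi u /\ lo [set u; v] = pi v.
Proof.
move=> uvE vu; have [uV vV] := adj_vertices (subxx _) uvE.
have [ee h] := endsP piH z uvE; rewrite /hi /lo.
move: ee h; move: (ends _ _ _) => [a b] /= ee ba.
have : a \in [set u; v] by rewrite ee !inE eqxx.
have : b \in [set u; v] by rewrite ee !inE eqxx orbT.
rewrite !inE => /orP[/eqP bu|/eqP bv] /orP[/eqP au|/eqP av].
- by rewrite bu au ltnn in ba.
- by rewrite bu av ltnNge (ltnW vu) in ba.
- by rewrite au bv.
- by rewrite av bv ltnn in ba.
Qed.

Definition edge_sign X e : bool := 0 <= dot (vec_at X (hi e)) (vec_at X (lo e)).

Definition fragile_edges X : {set {set 'I_n}} :=
  [set e in E | fragile (vec_at X) (hi e) (lo e)].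

Definition sign_prod X : R := \prod_(e in E) ((edge_sign X e)%:R - 1 / 2).

Lemma measurable_vec_at l i : measurable_fun setT (fun X => vec_at X l i).
Proof. exact: measurable_coord. Qed.

Lemma bmf_sign_prod : bmf sign_prod.
Proof.
apply: bmf_prod => e _; apply: bmfB; last exact: bmf_cst.
apply: bmf_bool; apply: measurable_fun_ler => //.
by apply: measurable_dot => i; exact: measurable_vec_at.
Qed.

Lemma norm_sign_prod X : `|sign_prod X| = (1 / 2) ^+ #|E|.
Proof.
rewrite /sign_prod normr_prod -prodr_const; apply: eq_bigr => e _.
by case: (edge_sign X e) => /=; rewrite ?sub0r ?normrN ger0_norm; lra.
Qed.

Lemma bmf_fragile_eq F : bmf (fun X => (fragile_edges X == F)%:R : R).
Proof.
have [FE|FE] := boolP (F \subset E); last first.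
  apply: (eq_bmf _ (bmf_cst 0)) => X; case: eqP => // h.
  by move: FE; rewrite -h => /negP[]; apply/fintype.subsetP => e; rewrite inE => /andP[].
apply: (eq_bmf (f := fun X => \prod_(e in E)
    (fragile (vec_at X) (hi e) (lo e) == (e \in F))%:R)).
  move=> X; have [h|h] := eqVneq (fragile_edges X) F.
    by rewrite big1// => e eE; rewrite -h inE eE eqxx.
  have /existsP[e] : [exists e in E, fragile (vec_at X) (hi e) (lo e) != (e \in F)].
    apply: contraNT h; rewrite negb_exists_in => /forall_inP h.
    apply/eqP/finset.setP => e; rewrite inE; have [eE|eE] := boolP (e \in E).
      by have := h e eE; rewrite negbK => /eqP.
    by apply/esym/negP => /(fintype.subsetP FE); rewrite (negPf eE).
  by move=> /andP[eE h']; rewrite (bigD1 e)//= (negPf h') mul0r.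
apply: bmf_prod => e _; apply: bmf_bool.
rewrite (_ : (fun X => _) = fun X => if e \in F then fragile (vec_at X) (hi e) (lo e)
    else ~~ fragile (vec_at X) (hi e) (lo e)); last first.
  by apply/funext => X; case: (e \in F); case: fragile.
have mf := measurable_fragile measurable_vec_at (hi e) (lo e).
by case: (e \in F) => //; exact: measurable_neg.
Qed.

Lemma sum_fragile_eq (p : pred {set {set 'I_n}}) X :
  \sum_(F | p F) (fragile_edges X == F)%:R = (p (fragile_edges X))%:R :> R.
Proof.
rewrite big_mkcond (bigD1 (fragile_edges X))//= big1 ?addr0.
  by rewrite eqxx; case: (p _).
by move=> F; rewrite eq_sym => /negPf ->; case: (p F).
Qed.

Lemma bmf_fragile_card m : bmf (fun X => (m <= #|fragile_edges X|)%N%:R : R).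
Proof.
have b : bmf (fun X => \sum_(F : {set {set 'I_n}} | (m <= #|F|)%N) (fragile_edges X == F)%:R : R).
  by apply: bmf_sum => F _; exact: bmf_fragile_eq.
apply: eq_bmf b => X; exact: (sum_fragile_eq (fun F => m <= #|F|)%N).
Qed.

Lemma vec_at_refl v s X :
  vec_at (refl_seq (fun X => gs (vec_at X) v) s X) =
  flip (vec_at X) v (fun l => vertex_at l \in s).
Proof.
apply/funext => l; apply/funext => i; rewrite /vec_at /flip tnth_mktuple.
by case: ifP => // _; rewrite tnth_mktuple.
Qed.

Lemma mean_uncovered F : ~~ strongly_covering pi F ->
  mean L (fun X => sign_prod X * (fragile_edges X == F)%:R) = 0.
Proof.
move=> Fc; have [FE|FE] := boolP (F \subset E); last first.
  rewrite -[RHS](mean_cst L); apply: eq_mean => X; case: eqP => [h|]; last by rewrite mulr0.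
  by move: FE; rewrite -h => /negP[]; apply/fintype.subsetP => e; rewrite inE => /andP[].
have [u [v [uvE uvF vu [uC C_gt C_v C_F]]]] := uncovered_edge piH FE Fc.
set C := component_ge pi F v u in uC C_gt C_v C_F.
pose r X := gs (vec_at X) (pi v).
pose p : pred nat := fun l => vertex_at l \in enum C.
have [uV vV] := adj_vertices (subxx _) uvE.
(* Labels from [k] on are sent to [z], which may lie in [C]; they exceed [pi v] anyway. *)
have p_gt l : p l -> (pi v < l)%N.
  rewrite /p mem_enum => lC; have [lk|lk] := ltnP l k.
    by rewrite -(pi_vertex_at lk).2 C_gt.
  exact: leq_trans (ltn_ord _) lk.
pose f X := sign_prod X * (fragile_edges X == F)%:R.
have bf : bmf f by apply: bmfM; [exact: bmf_sign_prod|exact: bmf_fragile_eq].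
suff fN X : f (refl_seq r (enum C) X) = - f X.
  have : mean L (f \o refl_seq r (enum C)) = mean L f.
    apply: (mean_refl_seq L_prod nu_unif) => //; last first.
    (* The direction involves only vectors of label at most [pi v], while [C] lies above. *)
    - move=> i; rewrite mem_enum => iC X y; apply: eq_gs => l lv.
      rewrite /vec_at tnth_upd; case: eqP => // li.
      have lk : (l < k)%N by exact: leq_ltn_trans lv (ltn_ord _).
      have := C_gt _ iC; rewrite -li (pi_vertex_at lk).2.
      by rewrite ltnNge lv.
    - exact: enum_uniq.
    - by move=> i; apply: measurable_gs => l j; exact: measurable_vec_at.
  rewrite (eq_mean L (g := fun X => -1 * f X)); last by move=> X /=; rewrite fN mulN1r.
  rewrite meanZ// -/f => h; apply/eqP.
  by rewrite -/f; move: h; move: (mean L f) => m h; apply/eqP; lra.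
have fragE Y : Y = refl_seq r (enum C) X -> fragile_edges Y = fragile_edges X.
  move=> ->; apply/finset.setP => e; rewrite !inE; congr (_ && _).
  by rewrite vec_at_refl -/p fragile_flip.
rewrite /f (fragE _ erefl); have [FX|_] := eqVneq (fragile_edges X) F; last by rewrite !mulr0 oppr0.
rewrite !mulr1 /sign_prod.
have [hu lv] := hi_lo_edge uvE vu.
rewrite (bigD1 [set u; v])//= [in RHS](bigD1 [set u; v])//=.
rewrite -[RHS]mulNr; congr (_ * _).
  rewrite /edge_sign vec_at_refl -/p hu lv sign_flip_edge//.
  - by case: (0 <= _) => /=; lra.
  - by rewrite /p vertex_at_pi// mem_enum.
  - by move: uvF; rewrite -FX /adj inE (uvE : _ \in E)/= hu lv.
apply: eq_bigr => e /andP[eE euv]; suff -> : edge_sign (refl_seq r (enum C) X) e = edge_sign X e by [].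
rewrite /edge_sign vec_at_refl -/p.
have [Cuv|Cuv] := eqVneq (p (hi e)) (p (lo e)); first by rewrite dot_flip2.
have /andP[lh hk] := lo_lt_hi eE.
have ee := edge_hi_lo eE; have [hV hE] := pi_vertex_at hk.
have lk := ltn_trans lh hk; have [lV lE] := pi_vertex_at lk.
apply: sign_flip_in => //.
  (* If the lower end were [v], the upper end would be a neighbour of [v] in [C], hence [u], and [e]
     the edge already set apart. *)
  apply: contraNneq euv => lov.
  have vl : vertex_at (lo e) = v by rewrite lov vertex_at_pi.
  have vC : v \notin C by apply/negP => /C_gt; rewrite ltnn.
  have hC : vertex_at (hi e) \in C.
    by move: Cuv; rewrite /p !mem_enum vl (negPf vC); case: (_ \in C).
  by rewrite ee vl (C_v _ hC)// -vl /adj -ee.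
(* A fragile edge belongs to [F]; above [v] it has both ends in [C] or none. *)
apply: contra Cuv => /andP[vl fr].
have eF : adj F (vertex_at (hi e)) (vertex_at (lo e)) by rewrite /adj -ee -FX inE eE.
by rewrite /p !mem_enum (C_F _ _ eF) ?lE ?hE// (ltn_trans vl).
Qed.

Lemma mean_sign_prod_le :
  `|mean L sign_prod| <= (1 / 2) ^+ #|E| *
    mean L (fun X => (SOEI_label pi <= #|fragile_edges X|)%N%:R).
Proof.
pose I F X : R := (fragile_edges X == F)%:R.
have bI F : bmf (I F) by exact: bmf_fragile_eq.
have bSI F : bmf (fun X => sign_prod X * I F X) by apply: bmfM => //; exact: bmf_sign_prod.
have sumI := sum_fragile_eq.
have -> : mean L sign_prod = \sum_(F | strongly_covering pi F) mean L (fun X => sign_prod X * I F X).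
  rewrite [RHS]big_mkcond/= -[LHS](eq_mean L (f := fun X => \sum_F sign_prod X * I F X)).
    rewrite mean_sum//; apply: eq_bigr => F _; case: ifPn => // /mean_uncovered; exact.
  by move=> X; rewrite -mulr_sumr (sumI xpredT) mulr1.
rewrite (le_trans (ler_norm_sum _ _ _))//.
apply: (@le_trans _ _ (\sum_(F | strongly_covering pi F) (1 / 2) ^+ #|E| * mean L (I F))).
  apply: ler_sum => F _; rewrite -meanZ//; apply: mean_norm_le => //; first exact: bmfZ.
  by move=> X; rewrite normrM norm_sign_prod ger0_norm// /I ler0n.
rewrite -mulr_sumr -mean_sum// ler_wpM2l ?exprn_ge0//.
apply: le_mean; first exact: bmf_sum.
  exact: bmf_fragile_card.
move=> X; rewrite (sumI (strongly_covering pi)) ler_nat.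
by case: (boolP (strongly_covering pi _)) => // /SOEI_label_min ->.
Qed.

Definition edge_prod (tau : R) X : R := \prod_(e in E)
  ((tau <= dot (vec_at X (hi e)) (vec_at X (lo e)))%R%:R - 1 / 2).

Lemma bmf_threshold (tau : R) l m :
  bmf (fun X => (tau <= dot (vec_at X l) (vec_at X m))%R%:R : R).
Proof.
apply: bmf_bool; apply: measurable_fun_ler => //.
by apply: measurable_dot => i; exact: measurable_vec_at.
Qed.

Lemma bmf_edge_prod tau : bmf (edge_prod tau).
Proof.
apply: bmf_prod => e _; apply: bmfB; last exact: bmf_cst.
exact: bmf_threshold.
Qed.

Lemma prod_sub_le (I : Type) (s : seq I) (p : pred I) (a b : I -> R) :
  (forall i, `|a i| <= 1) -> (forall i, `|b i| <= 1) ->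
  `|\prod_(i <- s | p i) a i - \prod_(i <- s | p i) b i| <=
  \sum_(i <- s | p i) `|a i - b i|.
Proof.
move=> a1 b1; elim: s => [|i s IH]; first by rewrite !big_nil subrr normr0.
rewrite !big_cons; case: ifP => // _.
set A := \prod_(_ <- _ | _) _ in IH *; set B := \prod_(_ <- _ | _) b _ in IH *.
rewrite (_ : a i * A - b i * B = (a i - b i) * A + b i * (A - B)); last by ring.
rewrite (le_trans (ler_normD _ _))// !normrM lerD//.
  by rewrite ler_piMr// normr_prod prodr_ile1// => j _; rewrite normr_ge0 a1.
by rewrite (le_trans _ IH)// ler_piMl.
Qed.

(** Replacing [tau] by 0 changes each factor on a null event only, and the two products differ by at
    most the sum of these changes. *)
Lemma mean_edge_prod (tau : R) :
  (forall i j : 'I_n, i != j ->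
    mean L (fun X => (tau <= dotp (tnth X i) (tnth X j))%R%:R) = 1 / 2) ->
  mean L (edge_prod tau) = mean L sign_prod.
Proof.
move=> h; have b0 := bmf_edge_prod 0; have bt := bmf_edge_prod tau.
apply/eqP; rewrite -subr_eq0 -(meanB L bt b0) -normr_le0.
pose D e X : R := `|(tau <= dot (vec_at X (hi e)) (vec_at X (lo e)))%R%:R -
   (0 <= dot (vec_at X (hi e)) (vec_at X (lo e)))%R%:R|.
have bD e : bmf (D e).
  have [mf [M fM]] := bmfB (bmf_threshold tau (hi e) (lo e)) (bmf_threshold 0 (hi e) (lo e)).
  by split; [exact: measurableT_comp|exists M => X; rewrite normr_id].
apply: (@le_trans _ _ (mean L (fun X => \sum_(e in E) D e X))).
  apply: mean_norm_le; [exact: bmfB|exact: bmf_sum|].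
  have half (b : bool) : `|b%:R - 1 / 2| <= 1 :> R.
    by case: b => /=; rewrite ler_norml; apply/andP; split; lra.
  move=> X; apply: (le_trans (prod_sub_le _ _ (fun e => half _) (fun e => half _))).
  apply: ler_sum => e _; rewrite /D.
  by rewrite opprB addrA subrK.
rewrite mean_sum// big1// => e eE; apply: (mean_threshold L_prod nu_unif).
  have /andP[lh hk] := lo_lt_hi eE.
  apply/eqP => hl; have := (pi_vertex_at hk).2.
  by rewrite hl (pi_vertex_at (ltn_trans lh hk)).2 => lhE; rewrite lhE ltnn in lh.
apply: h.
have /andP[lh hk] := lo_lt_hi eE.
apply/eqP => hl; have := (pi_vertex_at hk).2.
by rewrite hl (pi_vertex_at (ltn_trans lh hk)).2 => lhE; rewrite lhE ltnn in lh.
Qed.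

(** The left side orients an edge by the indices of its ends in ['I_n], the right side by their
    labels; each visits every edge once, and the inner product is symmetric. *)
Lemma edge_prodE tau X :
  \prod_(j < n) \prod_(i < n | (i < j)%N && adj E j i)
     (((j != i) && (tau <= dotp (tnth X j) (tnth X i)))%R%:R - 1 / 2) =
  edge_prod tau X.
Proof.
rewrite pair_big_dep/=.
pose D := [set p : 'I_n * 'I_n | (p.2 < p.1)%N && adj E p.1 p.2].
pose h (p : 'I_n * 'I_n) := [set p.1; p.2].
have hE : h @: D = E.
  apply/finset.setP => e; apply/imsetP/idP => [[p]|eE].
    by rewrite inE => /andP[_ pE] ->.
  have /eqP/cards2P[a [b [ab ee]]] := (edgesP eE).1.
  have [ltab|ltba|/val_inj abE] := ltngtP (val a) (val b).
  - by exists (b, a); rewrite ?inE /= ?ltab /adj /h /= finset.setUC -?ee.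
  - by exists (a, b) => //; rewrite inE /= ltba /adj -ee.
  - by rewrite abE eqxx in ab.
have hinj : {in D &, injective h}.
  move=> [a b] [a' b']; rewrite !inE /= => /andP[ab _] /andP[ab' _] hh.
  have: a \in [set a'; b'] by rewrite -[[set a'; b']]hh !inE eqxx.
  have: b \in [set a'; b'] by rewrite -[[set a'; b']]hh !inE eqxx orbT.
  rewrite !inE => /orP[/eqP bE|/eqP bE] /orP[/eqP aE|/eqP aE].
  - by rewrite aE bE ltnn in ab.
  - by rewrite aE bE ltnNge ltnW in ab.
  - by rewrite aE bE.
  - by rewrite aE bE ltnn in ab.
rewrite /edge_prod -[in RHS]hE big_imset//=.
apply: eq_big => [p|p /andP[iltj jiE]]; first by rewrite inE.
have pne : p.1 != p.2 by rewrite neq_ltn iltj orbT.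
rewrite pne /=.
have [uV vV] := adj_vertices (subxx _) jiE.
have : pi p.1 != pi p.2 by apply: contraNneq pne => /(pi_inj piH) ->.
rewrite -val_eqE neq_ltn => /orP[lt12|lt21].
  have jiE' : adj E p.2 p.1 by rewrite adjC.
  have [hh ll] := hi_lo_edge jiE' lt12.
  by rewrite /h finset.setUC hh ll /vec_at !vertex_at_pi// dotC.
have [hh ll] := hi_lo_edge jiE lt21.
by rewrite /h hh ll /vec_at !vertex_at_pi.
Qed.

(** * Probability of many fragile edges *)

Hypothesis kd : (k * 4 <= d)%N.
Implicit Type S : {set {set 'I_n}}.

Lemma vertex_at_inj l m : (l < k)%N -> (m < k)%N -> vertex_at l = vertex_at m -> l = m.
Proof. by move=> lk mk lm; rewrite -(pi_vertex_at lk).2 lm (pi_vertex_at mk).2. Qed.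

Lemma vec_at_upd m X y l : (m < k)%N -> (l < k)%N ->
  vec_at (upd (vertex_at m) X y) l = if l == m then tnth y else vec_at X l.
Proof.
move=> mk lk; rewrite /vec_at tnth_upd.
have [->|lm] := eqVneq l m; first by rewrite eqxx.
by case: eqP => // /(vertex_at_inj lk mk) lm'; rewrite lm' eqxx in lm.
Qed.

Lemma gs_upd m X y l : (m < k)%N -> (l < m)%N ->
  gs (vec_at (upd (vertex_at m) X y)) l = gs (vec_at X) l.
Proof.
move=> mk lm; apply: eq_gs => l' l'l; have l'm := leq_ltn_trans l'l lm.
by rewrite vec_at_upd// ?(ltn_trans l'm)// (ltn_eqF l'm).
Qed.

Lemma card_lt_ord m (D : {set 'I_d}) : (forall l, l \in D -> (l < m)%N) -> (#|D| <= m)%N.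
Proof.
move=> Dm; have [md|dm] := leqP m d; last first.
  by rewrite (leq_trans (max_card _))// card_ord ltnW.
rewrite -sum1_card (leq_trans (n := \sum_(l < d | (l < m)%N) 1))//.
  rewrite big_mkcond [leqRHS]big_mkcond /=; apply: leq_sum => l _.
  by case: ifP => // /Dm ->.
by rewrite -(big_ord_widen d (fun=> 1%N) md) sum1_card card_ord.
Qed.

(** The condition [|z_uv| <= t], without division, for the edges of [S] with upper label below [m].
    The nondegeneracy clause makes the [frame] vectors orthonormal, so that these are small ball
    constraints. *)
Definition small_coeffs (t : R) m S X : bool :=
  [forall l : 'I_m, rho (vec_at X) l != 0] &&
  [forall e in S, (hi e < m)%N ==>
    (coeff (vec_at X) (vec_at X (hi e)) (lo e) ^+ 2 <= t ^+ 2 * rho (vec_at X) (lo e))].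

Lemma measurable_forall (T : finType) (b : T -> n.-tuple (d.-tuple R) -> bool) :
  (forall i, measurable_fun setT (b i)) ->
  measurable_fun setT (fun X => [forall i, b i X]).
Proof.
move=> mb; rewrite (_ : (fun X => _) = fun X => all (fun i => b i X) (enum T)).
  elim: (enum T) => [|i s IH] /=; first exact: measurable_cst.
  exact: measurable_and.
apply/funext => X; apply/forallP/allP => [h i _|h i]; first exact: h.
by apply: h; rewrite mem_enum.
Qed.

Lemma bmf_small_coeffs t m S : bmf (fun X => (small_coeffs t m S X)%:R : R).
Proof.
apply: bmf_bool; apply: measurable_and; apply: measurable_forall => i.
  apply: measurable_neg; apply: measurable_fun_eqr => //.
  by apply: measurable_rho; exact: measurable_vec_at.
case: (i \in S) => /=; last exact: measurable_cst.
case: (hi i < m)%N => /=; last exact: measurable_cst.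
apply: measurable_fun_ler.
  apply: measurable_funX; apply: measurable_coeff => *; exact: measurable_vec_at.
by apply: measurable_funM => //; apply: measurable_rho; exact: measurable_vec_at.
Qed.

(** Induction on [m], integrating the vector of label [m] with the others frozen: the edges of [S]
    with upper label [m] constrain it along distinct directions of an orthonormal frame built from
    the earlier vectors. *)
Lemma mean_small_coeffs t m S : 0 < t -> k%:R * t ^+ 2 <= 1 / 2 ->
  S \subset E -> (m <= k)%N ->
  mean L (fun X => (small_coeffs t m S X)%:R) <=
  (12 * t * Num.sqrt d%:R) ^+ #|[set e in S | (hi e < m)%N]|.
Proof.
move=> t0 kt SE; elim: m => [_|m IH mk].
  rewrite (_ : #|_| = 0%N); last first.
    by apply/eqP; rewrite cards_eq0; apply/eqP/finset.setP => e; rewrite !inE andbF.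
  rewrite expr0 -[leRHS](mean_cst L); apply: le_mean; [exact: bmf_small_coeffs|exact: bmf_cst|].
  by move=> X; rewrite lern1 leq_b1.
pose c : R := 12 * t * Num.sqrt d%:R; rewrite -/c in IH *.
have c0 : 0 <= c by rewrite !mulr_ge0 ?sqrtr_ge0// ltW.
(* The lower ends of these edges, read as coordinate indices because [small_ball_frame] is indexed
   by ['I_d]; they fit since labels are below [k <= d]. *)
pose D := [set l : 'I_d | [exists e in S, (hi e == m) && (lo e == l :> nat)]].
have Dlt l : l \in D -> (l < m)%N.
  rewrite inE => /existsP[e /and3P[eS /eqP <- /eqP <-]].
  by have /andP[] := lo_lt_hi (fintype.subsetP SE _ eS).
have Dm : (#|D| <= m)%N by exact: card_lt_ord.
have cardS : #|[set e in S | (hi e < m.+1)%N]| = (#|D| + #|[set e in S | (hi e < m)%N]|)%N.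
  rewrite [in LHS](_ : finset _ = [set e in S | hi e == m] :|: [set e in S | (hi e < m)%N]); last first.
    by apply/finset.setP => e; rewrite !inE ltnS leq_eqVlt; case: (e \in S).
  rewrite cardsU (_ : _ :&: _ = finset.set0) ?cards0 ?subn0; last first.
    by apply/finset.setP => e; rewrite !inE; case: eqP => [->|]; rewrite ?ltnn !(andbF, andFb).
  congr (_ + _)%N; pose h (l : 'I_d) := [set vertex_at m; vertex_at l].
  have -> : [set e in S | hi e == m] = h @: D.
    apply/finset.setP => e; rewrite inE; apply/andP/imsetP => [[eS /eqP em]|[l]].
      have eE := fintype.subsetP SE _ eS; have /andP[lh _] := lo_lt_hi eE.
      have ld : (lo e < d)%N by lia.
      exists (Ordinal ld); last by rewrite /h /= -em; exact: edge_hi_lo.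
      by rewrite inE; apply/existsP; exists e; rewrite eS em !eqxx.
    rewrite inE => /existsP[e' /and3P[eS /eqP em /eqP el]] ->.
    rewrite /h -em -el -edge_hi_lo ?eS ?em//.
    exact: (fintype.subsetP SE).
  rewrite card_in_imset// => l l' /Dlt lm /Dlt lm' /finset.setP hh.
  have vneq a : (a < m)%N -> vertex_at a != vertex_at m.
    move=> am; apply/negP => /eqP /(vertex_at_inj (ltn_trans am mk) mk) h'.
    by rewrite h' ltnn in am.
  apply/val_inj/vertex_at_inj; rewrite ?(ltn_trans _ mk)//; apply/eqP.
  by have := hh (vertex_at l); rewrite !inE eqxx orbT (negPf (vneq _ lm)).
rewrite cardS exprD (le_trans _ (ler_wpM2l _ (IH (ltnW mk)))) ?exprn_ge0//.
have bA := bmf_small_coeffs t m S; have bA1 := bmf_small_coeffs t m.+1 S.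
rewrite -meanZ// (mean_resample L_prod (vertex_at m) bA1).2.
apply: le_mean; [exact: (mean_resample L_prod (vertex_at m) bA1).1|exact: bmfZ|].
move=> X.
have bX : bmf (fun y => (small_coeffs t m.+1 S (upd (vertex_at m) X y))%:R : R).
  exact: (bmf_comp (measurable_upd2 (vertex_at m) X) bA1).
have up y : small_coeffs t m.+1 S (upd (vertex_at m) X y) -> small_coeffs t m S X /\
    {in D, forall l : 'I_d, dot (tnth y) (frame (vec_at X) l) ^+ 2 <= t ^+ 2}.
  move=> /andP[/forallP r0 /forall_inP h].
  have rX l : (l < m)%N -> rho (vec_at X) l != 0.
    move=> lm; have := r0 (Ordinal (ltn_trans lm (ltnSn m))).
    by rewrite /rho /= gs_upd.
  have hX e : e \in S -> (hi e <= m)%N ->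
      coeff (vec_at X) (if hi e == m then tnth y else vec_at X (hi e)) (lo e) ^+ 2 <=
        t ^+ 2 * rho (vec_at X) (lo e).
    move=> eS em; have /andP[lh hk] := lo_lt_hi (fintype.subsetP SE _ eS).
    have := h e eS; rewrite ltnS em /= /coeff /rho gs_upd ?(leq_trans lh)//.
    by rewrite vec_at_upd.
  split.
    apply/andP; split; first by apply/forallP => l; exact: rX.
    apply/forall_inP => e eS; apply/implyP => em.
    by have := hX e eS (ltnW em); rewrite (ltn_eqF em).
  move=> l lD; have lm := Dlt _ lD; move: lD; rewrite inE.
  move=> /existsP[e /and3P[eS /eqP em /eqP el]].
  have := hX e eS; rewrite em leqnn eqxx el => /(_ isT).
  by rewrite dot_frame ler_pdivrMr// lt_def rX// rho_ge0.
have [AX|AX] := boolP (small_coeffs t m S X); last first.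
  rewrite mulr0 -[leRHS](mean_cst (nu (vertex_at m))); apply: le_mean => //; first exact: bmf_cst.
  by move=> y; case: (boolP (small_coeffs _ _ _ (upd _ _ _))) => // /up[]; rewrite (negPf AX).
rewrite mulr1.
have orth : {in D &, forall l l' : 'I_d,
    dot (frame (vec_at X) l) (frame (vec_at X) l') = (l == l')%:R}.
  have /andP[/forallP r0 _] := AX.
  move=> l l' /Dlt lm /Dlt lm'; rewrite frame_orth//.
    exact: (r0 (Ordinal lm)).
  exact: (r0 (Ordinal lm')).
apply: le_trans (small_ball_frame (nu_unif (vertex_at m)) (e := fun l : 'I_d => frame (vec_at X) l) t0 _ _ orth).
- apply: le_mean => //.
    by apply: bmf_ind; exact: measurable_dot_ball.
  move=> y; case: (boolP (small_coeffs _ _ _ (upd _ _ _))) => [/up[_ h]|_].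
    by rewrite indicE mem_set.
  by rewrite indicE ler0n.
- by move: Dm kd mk; set a := #|D|; set b := #|vertices H|; lia.
- rewrite (le_trans _ kt)// ler_wpM2r ?sqr_ge0// ler_nat.
  exact: leq_trans Dm (ltnW mk).
Qed.

Lemma expR1_ge1 : 1 <= 2 * expR 1 :> R.
Proof.
have : 1 <= expR 1 :> R by rewrite -{1}expR0 ler_expR.
lra.
Qed.

Lemma bmf_tail q l :
  bmf (fun X => (q < proj2 (vec_at X) l (vec_at X l))%R%:R : R).
Proof.
apply: bmf_bool; apply: measurable_fun_ltr => //.
by apply: measurable_proj2 => *; exact: measurable_vec_at.
Qed.

Lemma mean_tail q l : (l < k)%N ->
  mean L (fun X => (q < proj2 (vec_at X) l (vec_at X l))%R%:R) <=
  (2 * expR 1) ^+ k * expR (- (d%:R / 8 * q)).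
Proof.
move=> lk; have b := bmf_tail q l.
rewrite (mean_resample L_prod (vertex_at l) b).2 -[leRHS](mean_cst L).
apply: le_mean; [exact: (mean_resample L_prod (vertex_at l) b).1|exact: bmf_cst|].
(* Degenerate steps are left out since their [frame] vectors are 0 instead of unit vectors; they add
   nothing to [proj2], division by 0 giving 0. *)
move=> X; pose D := [set m : 'I_d | (m < l)%N && (rho (vec_at X) m != 0)].
have Dl : (#|D| <= l)%N by apply: card_lt_ord => m; rewrite inE => /andP[].
have ld : (l <= d)%N by lia.
have Dd : (#|D| * 4 <= d)%N by move: Dl kd lk; set a := #|D|; set c := #|vertices H|; lia.
have orth : {in D &, forall m m' : 'I_d,
    dot (frame (vec_at X) m) (frame (vec_at X) m') = (m == m')%:R}.
  by move=> m m'; rewrite !inE => /andP[_ rm] /andP[_ rm']; exact: frame_orth.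
apply: (@le_trans _ _ ((2 * expR 1) ^+ #|D| * expR (- (d%:R / 8 * q)))); last first.
  rewrite ler_wpM2r ?expR_ge0// ler_weXn2l ?expR1_ge1//.
  by rewrite (leq_trans Dl)// ltnW.
rewrite (le_trans _ (tail_frame (nu_unif (vertex_at l)) q Dd orth))//.
rewrite le_eqVlt; apply/orP; left; apply/eqP; apply: eq_mean => y.
rewrite indicE; congr (nat_of_bool _)%:R.
have -> : proj2 (vec_at (upd (vertex_at l) X y)) l (vec_at (upd (vertex_at l) X y) l) =
    \sum_(m in D) dot (tnth y) (frame (vec_at X) m) ^+ 2.
  rewrite vec_at_upd// eqxx /proj2.
  rewrite (eq_bigr (fun m : 'I_l => coeff (vec_at X) (tnth y) m ^+ 2 / rho (vec_at X) m)); last first.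
    by move=> m _; rewrite /coeff /rho gs_upd.
  rewrite (big_ord_widen d (fun m => coeff (vec_at X) (tnth y) m ^+ 2 / rho (vec_at X) m) ld).
  rewrite [LHS]big_mkcond [RHS]big_mkcond; apply: eq_bigr => m _.
  rewrite inE dot_frame; case: (m < l)%N => //=.
  by case: eqVneq => // ->; rewrite invr0 mulr0.
by apply/idP/idP => [h|/set_mem//]; exact: mem_set.
Qed.

Lemma subset_of_card (T : finType) (A : {set T}) m : (m <= #|A|)%N ->
  exists B : {set T}, B \subset A /\ #|B| = m.
Proof.
move=> /card_geqP[s [us sm sA]]; exists [set a in s]; split.
  by apply/fintype.subsetP => a; rewrite inE; exact: sA.
by rewrite cardsE -sm; exact/card_uniqP.
Qed.

Lemma bin_le_expn a m : ('C(a, m) <= a ^ m)%N.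
Proof.
elim: m => [|m IH]; first by rewrite bin0.
have h := mul_bin_left a m.
rewrite expnS (leq_trans _ (leq_mul (leqnn a) IH))//.
apply: (@leq_trans (m.+1 * 'C(a, m.+1))); first by rewrite leq_pmull.
by rewrite h leq_mul2r leq_subr orbT.
Qed.

(** Off the bad event, [rho >= 1 - q >= 1/2] and both projections in the definition of a fragile
    edge are at most [q], so [z_uv^2 <= 2 q^2 <= t^2] with [t = 2 q]. The first term pays for the
    bad event; the second is a union bound over at most [|E|^s] sets of edges. *)
Lemma mean_fragile_le (q : R) s : 0 < q -> q <= 1 / 2 -> k%:R * (2 * q) ^+ 2 <= 1 / 2 ->
  mean L (fun X => (s <= #|fragile_edges X|)%N%:R) <=
  k%:R * ((2 * expR 1) ^+ k * expR (- (d%:R / 8 * q))) +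
  #|E|%:R ^+ s * (24 * q * Num.sqrt d%:R) ^+ s.
Proof.
move=> q0 q2 kq; pose t := 2 * q; have t0 : 0 < t by rewrite mulr_gt0.
(* A sum of two indicators: it is at least 1 exactly when the vector leaves the sphere or has a
   large projection. *)
pose bad (l : 'I_k) X : R := (1 - \1_(@sphere R d) (tnth X (vertex_at l))) +
  (q < proj2 (vec_at X) l (vec_at X l))%R%:R.
have bS (l : 'I_k) : bmf (fun X => 1 - \1_(@sphere R d) (tnth X (vertex_at l)) : R).
  have b : bmf (fun y : d.-tuple R => 1 - \1_(@sphere R d) y : R).
    by apply: bmfB; [exact: bmf_cst|exact: bmf_sphere].
  exact: (bmf_comp (measurable_tnth _) b).
have bbad l : bmf (bad l) by apply: bmfD; [exact: bS|exact: bmf_tail].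
pose G S X : R := (small_coeffs t k S X)%:R.
pose draws : {set {set {set 'I_n}}} := [set S : {set {set 'I_n}} | (S \subset E) && (#|S| == s)].
have bG S : bmf (G S) by exact: bmf_small_coeffs.
have bad0 l X : 0 <= bad l X.
  by rewrite addr_ge0// indicE; case: (_ \in _); rewrite ?subrr ?subr0.
have le1 X : (s <= #|fragile_edges X|)%N%:R <= \sum_l bad l X + \sum_(S in draws) G S X.
  have G0 : 0 <= \sum_(S in draws) G S X by apply: sumr_ge0 => S _; rewrite ler0n.
  have B0 : 0 <= \sum_l bad l X by apply: sumr_ge0 => l _.
  have [/subset_of_card[S [Sf Ss]]|_] := boolP (s <= _)%N; last by rewrite addr_ge0.
  have [/existsP[l hl]|] := boolP [exists l, 1 <= bad l X].
    rewrite (le_trans hl)// (bigD1 l)//= -addrA lerDl addr_ge0//.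
    by apply: sumr_ge0 => l' _.
  rewrite negb_exists => /forallP nb.
  have good (l : nat) : (l < k)%N -> sphere (tnth X (vertex_at l)) /\
      proj2 (vec_at X) l (vec_at X l) <= q.
    move=> lk; have := nb (Ordinal lk); rewrite /bad /= -ltNge indicE.
    case: (boolP (tnth X (vertex_at l) \in _)) => [/set_mem Sl|_].
      by rewrite subrr add0r; case: (leP (proj2 _ _ _) q) => //; rewrite ltxx.
    by rewrite subr0; case: (q < _) => /=; lra.
  have rhoq (l : nat) : (l < k)%N -> 1 - q <= rho (vec_at X) l.
    move=> lk; have [Sl Nl] := good l lk.
    by rewrite rhoE (_ : dot _ _ = 1)//; lra.
  have -> : true%:R = G S X.
    rewrite /G (_ : small_coeffs t k S X)//; apply/andP; split.
      apply/forallP => l; rewrite gt_eqF// (lt_le_trans _ (rhoq _ (ltn_ord l)))//; lra.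
    apply/forall_inP => e eS; apply/implyP => _.
    have := fintype.subsetP Sf _ eS; rewrite inE => /andP[eE fr].
    have /andP[lh hk] := lo_lt_hi eE; have lk := ltn_trans lh hk.
    (* [proj2] grows with the number of directions, so the upper vector's projection on the first
       [lo e] of them is also at most [q]. *)
    apply: (le_trans fr); apply: (@le_trans _ _ (q * q)).
      apply: ler_pM; rewrite ?proj2_ge0//; last by have [] := good _ lk.
      by apply: le_trans (good _ hk).2; apply: proj2_mono; exact: ltnW.
    have := rhoq _ lk; rewrite /t => r1.
    have -> : (2 * q) ^+ 2 * rho (vec_at X) (lo e) = q * q * (4 * rho (vec_at X) (lo e)) by ring.
    by rewrite ler_peMr ?mulr_ge0 ?(ltW q0)//; lra.
  have Sd : S \in draws.
    rewrite inE Ss eqxx andbT (fintype.subset_trans Sf)//.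
    by apply/fintype.subsetP => e; rewrite inE => /andP[].
  rewrite (bigD1 S)//= addrCA lerDl addr_ge0//.
  by apply: sumr_ge0 => S' _; rewrite ler0n.
apply: (@le_trans _ _ (mean L (fun X => \sum_l bad l X + \sum_(S in draws) G S X))).
  apply: le_mean => //; first exact: bmf_fragile_card.
  by apply: bmfD; [exact: bmf_sum|exact: bmf_sum].
rewrite meanD ?mean_sum//; [|exact: bmf_sum|exact: bmf_sum].
apply: lerD.
  rewrite mulr_natl -[in leRHS](card_ord k) -sumr_const; apply: ler_sum => l _.
  rewrite meanD; [|exact: bS|exact: bmf_tail].
  rewrite (mean_off_sphere L_prod nu_unif) add0r card_ord.
  exact: mean_tail.
have c0 : 0 <= 24 * q * Num.sqrt d%:R by rewrite !mulr_ge0 ?sqrtr_ge0// ltW.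
apply: (@le_trans _ _ (\sum_(S in draws) (24 * q * Num.sqrt d%:R) ^+ s)).
  apply: ler_sum => S; rewrite inE => /andP[SE /eqP Ss].
  apply: le_trans (mean_small_coeffs t0 kq SE (leqnn k)) _.
  rewrite (_ : 12 * t = 24 * q); last by rewrite /t; ring.
  rewrite (_ : finset _ = S) ?Ss//; apply/finset.setP => e; rewrite inE.
  case: (boolP (e \in S)) => //= /(fintype.subsetP SE) eE.
  by have /andP[] := lo_lt_hi eE.
rewrite sumr_const cards_draws -[leLHS]mulr_natl ler_wpM2r ?exprn_ge0//.
by rewrite -natrX ler_nat bin_le_expn.
Qed.

End SignedEdges.

(** * Choice of the constants *)

Lemma ln_natr_ge (R : realType) (d : nat) : (1 < d)%N -> 1 / 4 <= ln (d%:R : R).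
Proof.
move=> d1; have h : expR (1 / 4) <= (d%:R : R).
  apply: (@le_trans _ _ 2); last by rewrite ler_nat.
  have h1 := expR_ge1Dx (- (1 / 4) : R).
  have h2 : expR (1 / 4) * expR (- (1 / 4)) = 1 :> R by rewrite -expRD subrr expR0.
  have h3 := expR_gt0 (1 / 4 : R).
  have h4 : expR (1 / 4) * (3 / 4) <= expR (1 / 4) * expR (- (1 / 4)) :> R.
    by rewrite ler_pM2l//; lra.
  by rewrite h2 in h4; lra.
by rewrite -(expRK (1 / 4)) ler_ln ?posrE ?expR_gt0// ltr0n (ltn_trans _ d1).
Qed.

(* The value [q] is [100 k ln d / d]; the constant [96 * 100] makes
   [24 q sqrt d |E|] at most half of the base of the power. *)
Lemma numeric_bounds (R : realType) (k m s d : nat) (B : R) :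
  (1 < d)%N -> (0 < m)%N -> (0 < s <= k)%N ->
  B = 96 * 100 * k%:R * m%:R * (ln d%:R `^ (3 / 2)) / Num.sqrt d%:R -> B < 1 ->
  exists q : R, [/\ 0 < q, q <= 1 / 2, k%:R * (2 * q) ^+ 2 <= 1 / 2, (k * 4 <= d)%N &
    k%:R * ((2 * expR 1) ^+ k * expR (- (d%:R / 8 * q))) +
      m%:R ^+ s * (24 * q * Num.sqrt d%:R) ^+ s <= B ^+ s].
Proof.
move=> d1 m1 /andP[s1 sk] BE B1.
have k1 : (0 < k)%N by exact: leq_trans s1 sk.
set l := ln d%:R in BE; set r := Num.sqrt d%:R in BE *.
have l4 : 1 / 4 <= l by exact: ln_natr_ge.
have l0 : 0 < l by lra.
have d0 : 0 < d%:R :> R by rewrite ltr0n (ltn_trans _ d1).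
have r0 : 0 < r by rewrite sqrtr_gt0.
have r1 : 1 <= r by rewrite -sqrtr1 ler_sqrt// ler1n (ltn_trans _ d1).
have rd : d%:R = r ^+ 2 by rewrite sqr_sqrtr// ltW.
pose sl := Num.sqrt l.
have sl2 : 1 / 2 <= sl.
  have -> : 1 / 2 = Num.sqrt (1 / 4) :> R.
    by rewrite (_ : 1 / 4 = (1 / 2) ^+ 2 :> R) ?sqrtr_sqr ?ger0_norm//; field.
  by rewrite ler_sqrt// ltW.
have lamE : l `^ (3 / 2) = l * sl.
  rewrite (_ : 3 / 2 = 1 + 2^-1 :> R); last by field.
  by rewrite powRD ?(gt_eqF l0) ?implybT// powRr1 ?ltW// powR12_sqrt// ltW.
set lam := l `^ _ in BE lamE.
(* Since [ln d >= 1/4], its square root is at least 1/2, and [(ln d)^(3/2)] dominates [ln d] up to a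
   factor 2. *)
have lam2 : l <= 2 * lam by rewrite lamE; nra.
have lam8 : 1 / 8 <= lam by rewrite lamE; nra.
have kR : 1 <= k%:R :> R by rewrite ler1n.
have mR : 1 <= m%:R :> R by rewrite ler1n.
have Br : B * r = 96 * (100 * (k%:R * m%:R * lam)) by rewrite BE; field; rewrite gt_eqF.
have klam : k%:R * lam <= k%:R * m%:R * lam.
  by rewrite ler_wpM2r ?ler_peMr//; lra.
have k8 : k%:R <= 8 * (k%:R * lam) by rewrite mulrCA ler_peMr//; lra.
(* This is [B < 1] rewritten; the upper bounds on [q] and [k] all come from it. *)
have kml_r : 96 * (100 * (k%:R * m%:R * lam)) < r by rewrite -Br gtr_pMl.
pose q := 100 * k%:R * l / d%:R.
have q0 : 0 < q by rewrite divr_gt0// mulr_gt0// mulr_gt0// (lt_le_trans ltr01).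
have qd : q * d%:R = 100 * (k%:R * l) by rewrite /q; field; rewrite gt_eqF.
clearbody q.
have kl2 : k%:R * l <= 2 * (k%:R * lam) by rewrite mulrCA ler_wpM2l.
have qr : q * r <= 1 / 48.
  rewrite -(ler_pM2r r0) -mulrA -expr2 -rd qd; lra.
have qle : q <= 1 / 48 by rewrite (le_trans _ qr)// ler_peMr// ltW.
have krR : k%:R <= r by lra.
exists q; split => //.
- lra.
- have -> : k%:R * (2 * q) ^+ 2 = 4 * (k%:R * q * q) by ring.
  have : k%:R * q * q <= r * q * q by rewrite ler_wpM2r ?ler_wpM2r// ltW.
  have : r * q * q <= 1 / 48 * (1 / 48).
    by rewrite (mulrC r); apply: ler_pM => //; [apply: mulr_ge0|]; exact: ltW.
  lra.
- have : k%:R * 4 <= d%:R :> R by rewrite rd expr2; nra.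
  by rewrite -natrM ler_nat.
have Bhalf : r^-1 <= B / 2.
  rewrite -(ler_pM2r r0) mulVf ?gt_eqF// mulrAC Br; lra.
have B0 : 0 < B / 2 by rewrite (lt_le_trans _ Bhalf)// invr_gt0.
have rexp : r^-1 = expR (- (l / 2)).
  rewrite expRN; congr (_^-1); apply/eqP; rewrite -(eqrXn2 (n := 2))// ?ltW ?expR_gt0//.
  rewrite -rd -expRM_natl (_ : 2%:R * (l / 2) = l) ?lnK ?posrE//.
  by field.
(* [24 m q d = 2400 k m ln d] is at most [4800 k m (ln d)^(3/2)], which is half of [B sqrt d]: hence
   96 = 24 * 2 * 2. *)
have term2 : m%:R ^+ s * (24 * q * r) ^+ s <= (B / 2) ^+ s.
  rewrite -exprMn lerXn2r ?nnegrE ?(ltW B0) ?mulr_ge0 ?(ltW q0) ?(ltW r0)//.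
  rewrite -(ler_pM2r r0) [leRHS]mulrAC.
  have -> : m%:R * (24 * q * r) * r = 24 * m%:R * (q * r ^+ 2) by ring.
  rewrite -rd qd.
  have h : m%:R * (k%:R * l) <= 2 * (k%:R * m%:R * lam).
    have -> : 2 * (k%:R * m%:R * lam) = m%:R * (2 * (k%:R * lam)) by ring.
    by rewrite ler_wpM2l//; lra.
  have -> : 24 * m%:R * (100 * (k%:R * l)) = 24 * (100 * (m%:R * (k%:R * l))) by ring.
  by rewrite Br; lra.
(* [k (2 e)^k <= e^(3 k)], and the tail exponent is [(100/8) k ln d]. Setting aside [(1/2) k ln d]
   for the power [d^(-k/2)] leaves [12 k ln d >= 3 k], where 100 and [ln d >= 1/4] meet. Then
   [s <= k] allows passing from the power [k] to the power [s]. *)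
have term1 : k%:R * ((2 * expR 1) ^+ k * expR (- (d%:R / 8 * q))) <= (B / 2) ^+ s.
  apply: (@le_trans _ _ ((B / 2) ^+ k)); last first.
    by rewrite ler_wiXn2l ?(ltW B0)//; lra.
  apply: (@le_trans _ _ (r^-1 ^+ k)); last first.
    by rewrite lerXn2r ?nnegrE ?(ltW B0) ?invr_ge0 ?(ltW r0).
  have e2 : 2 <= expR 1 :> R by have := expR_ge1Dx (1 : R); lra.
  have ke : k%:R <= expR 1 ^+ k :> R.
    apply: (@le_trans _ _ (2 ^+ k)); last by rewrite lerXn2r ?nnegrE ?expR_ge0.
    by rewrite -natrX ler_nat ltnW// ltn_expl.
  have ee : (2 * expR 1) ^+ k <= (expR 1 * expR 1) ^+ k :> R.
    by rewrite lerXn2r ?nnegrE ?mulr_ge0 ?expR_ge0// ler_wpM2r ?expR_ge0.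
  apply: (@le_trans _ _ (expR 1 ^+ k * ((expR 1 * expR 1) ^+ k * expR (- (d%:R / 8 * q))))).
    apply: ler_pM; rewrite ?mulr_ge0 ?exprn_ge0 ?mulr_ge0 ?expR_ge0//.
    by rewrite ler_wpM2r ?expR_ge0.
  rewrite mulrA -exprMn -!expRD -expRM_natl -expRD rexp -expRM_natl ler_expR.
  have -> : d%:R / 8 * q = 100 / 8 * (k%:R * l) by rewrite mulrAC (mulrC _ q) qd; field.
  have : k%:R * (1 / 4) <= k%:R * l by rewrite ler_wpM2l.
  nra.
have := lerD term1 term2; move=> /le_trans; apply.
have -> : (B / 2) ^+ s + (B / 2) ^+ s = B ^+ s * (2 * (2^-1) ^+ s) by rewrite exprMn; ring.
rewrite ler_piMr ?exprn_ge0//; first lra.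
case: s s1 {sk term1 term2} => // s _; rewrite exprS mulrA divff// mul1r exprn_ile1//; lra.
Qed.

(** * The bound for random geometric graphs *)

Lemma labelling_exists (T : finType) (H : graph T) (z : T) (zV : z \in vertices H) :
  exists pi : {ffun T -> 'I_#|vertices H|}, labelling pi.
Proof.
pose pi := [ffun w => enum_rank_in zV w] : {ffun T -> 'I_#|vertices H|}.
have pi_inj : {in vertices H &, injective pi}.
  by move=> a b aV bV; rewrite !ffunE; exact: (enum_rank_in_inj (A := vertices H)).
exists pi; apply/andP; split; first exact/dinjectiveP.
rewrite eqEcard finset.subsetT /= cardsT card_ord.
by rewrite (card_in_imset pi_inj).
Qed.

(** If the base is at least 1 or the exponent is 0, bounding the probability by 1 suffices; a graph
    without edges has exponent 0. What remains is the range of [numeric_bounds]. *)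
Lemma mean_sign_prod_SOEI (R : realType) (n d : nat) (H : graph 'I_n)
    (pi : {ffun 'I_n -> 'I_#|vertices H|}) (z : 'I_n)
    (L : probability (n.-tuple (d.-tuple R)) R) (nu : 'I_n -> probability (d.-tuple R) R) :
  labelling pi ->
  (forall A : 'I_n -> set (d.-tuple R), (forall i, measurable (A i)) ->
    L [set X | forall i, A i (tnth X i)]%classic = (\prod_(i < n) nu i (A i))%E) ->
  (forall i, uniform_on_sphere (nu i)) -> (1 < d)%N ->
  `|mean L (sign_prod pi z)| <= (1 / 2) ^+ #|edges H| *
    (96 * 100 * #|vertices H|%:R * #|edges H|%:R * (ln d%:R `^ (3 / 2)) / Num.sqrt d%:R)
      ^+ SOEI_label pi.
Proof.
move=> piH L_prod nu_unif d1; set B := _ / Num.sqrt _.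
rewrite (le_trans (mean_sign_prod_le piH z L_prod nu_unif))// ler_wpM2l ?exprn_ge0//.
set s := SOEI_label pi.
have bs := @bmf_fragile_card R n d H pi z s.
have triv : mean L (fun X : n.-tuple (d.-tuple R) => (s <= #|fragile_edges pi z X|)%N%:R) <= 1.
  rewrite -[leRHS](mean_cst L); apply: le_mean; [exact: bs|exact: bmf_cst|].
  by move=> X; rewrite lern1 leq_b1.
have [B1|B1] := leP 1 B; first exact: le_trans triv (exprn_ege1 _ B1).
have [s0|s0] := posnP s; first by rewrite {2}s0 expr0.
have m0 : (0 < #|edges H|)%N.
  rewrite lt0n; apply/negP => /eqP m0.
  have := SOEI_label_min (strongly_covering_edges pi); rewrite m0 leqn0 => /eqP h.
  by move: s0; rewrite /s h.
have ssk : (0 < s <= #|vertices H|)%N by rewrite s0 SOEI_label_le.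
have [q [q0 q2 kq kd bound]] := numeric_bounds d1 m0 ssk (erefl B) B1.
exact: le_trans (mean_fragile_le piH z L_prod nu_unif kd s q0 q2 kq) bound.
Qed.

Theorem proposition1p3 (R : realType) (eps gamma : R)
    (eps_gt0 : 0 < eps) (gamma_gt0 : 0 < gamma) :
  exists C : R, 0 < C /\
  forall (n d : nat) (p : R),
    p = 1 / 2 ->
    p <= 1 / 2 -> n%:R `^ (-1 + eps) <= p ->
    n%:R `^ gamma <= d%:R ->
  forall (H : graph 'I_n), connected_graph H ->
  forall (disp : measure_display) (Omega : measurableType disp)
         (P : probability Omega R) (V : 'I_n -> {RV P >-> d.-tuple R})
         (tau : R),
    is_RGG V p tau ->
    (`| 'E_P[ fun w => (\prod_(j < n) \prod_(i < n | (i < j)%N && adj (edges H) j i)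
                ((RGG_edge V tau w j i)%:R - 1 / 2))%R ] |
     <= ((1 / 2) ^+ #|edges H|
         * (C * #|vertices H|%:R * #|edges H|%:R * (ln d%:R `^ (3 / 2))
            / Num.sqrt d%:R) ^+ SOEI H)%:E)%E.
Proof.
exists (96 * 100); split; first by rewrite mulr_gt0.
move=> n d p p2 _ np nd H [/set0Pn[z zV] _] disp Omega P V tau [indep unif prob].
(* For [n = 1] the power [n^(-1 + eps)] would be 1, more than [p]. Then [d >= n^gamma > 1], so that
   [ln d > 0]. *)
have n1 : (1 < n)%N.
  rewrite ltn_neqAle (leq_ltn_trans _ (ltn_ord z))// andbT.
  by apply: contraL np => /eqP <-; rewrite powR1 p2 -ltNge; lra.
have d1 : (1 < d)%N.
  have e1 : 1 `^ gamma = 1 :> R by rewrite powR1.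
  rewrite -(ltr1n R) (lt_le_trans _ nd)// -[ltLHS]e1.
  by apply: gt0_ltr_powR; rewrite ?nnegrE ?ltr1n.
have [pi0 pi0H] := labelling_exists zV.
(* The maximum is over a nonempty set of labellings, hence attained; the bound holds for each of
   them. *)
have [|pi piH SE] := @eq_bigmax_cond _ [pred pi : {ffun 'I_n -> 'I_#|vertices H|} | labelling pi]
  (fun pi => SOEI_label pi).
  by apply/card_gt0P; exists pi0.
have -> : SOEI H = SOEI_label pi by rewrite -SE.
(* The sample is packed into one random tuple, and the expectation is computed under its law [L]. *)
pose VV w := [tuple V i w | i < n].
have mVV : measurable_fun setT VV.
  apply/measurable_fun_tnthP => i.
  rewrite (_ : _ \o _ = V i); last by apply/funext => w /=; rewrite tnth_mktuple.
  exact: measurable_funPT.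
pose mixin := isMeasurableFun.Build _ _ _ _ VV mVV.
pose VVm : {mfun Omega >-> n.-tuple (d.-tuple R)} := HB.pack VV mixin.
pose L := distribution P VVm : probability _ R.
pose nu i := distribution P (V i) : probability _ R.
have L_prod A : (forall i, measurable (A i)) ->
    L [set X | forall i, A i (tnth X i)]%classic = (\prod_(i < n) nu i (A i))%E.
  move=> mA; rewrite -(indep A mA) /L /distribution /pushforward /=; congr (P _).
  by apply/seteqP; split=> w h i; have := h i; rewrite tnth_mktuple.
have half i j : i != j ->
    mean L (fun X => (tau <= dotp (tnth X i) (tnth X j))%R%:R) = 1 / 2.
  move=> ij.
  have b : bmf (fun X : n.-tuple (d.-tuple R) =>
      (tau <= dotp (tnth X i) (tnth X j))%R%:R : R).
    apply: bmf_bool; apply: measurable_fun_ler => //.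
    by apply: measurable_dot => l; exact: measurable_coord.
  rewrite -(mean_transfer (P := P) mVV _ b)// -p2.
  apply: EFin_inj; rewrite -(prob i j ij) -mean_ind.
    congr (_%:E); apply: eq_mean => w /=; rewrite !tnth_mktuple indicE.
    congr (nat_of_bool _)%:R; apply/idP/idP => [h|/set_mem//]; exact: mem_set.
  rewrite -[X in measurable X]setTI; apply: measurable_fun_ler => //.
  apply: measurable_dot => l; apply: (measurableT_comp (measurable_tnth l)) => //.
have b := @bmf_edge_prod R n d H pi z tau.
have -> : 'E_P[ fun w => (\prod_(j < n) \prod_(i < n | (i < j)%N && adj (edges H) j i)
                ((RGG_edge V tau w j i)%:R - 1 / 2))%R ]%E = (mean L (edge_prod pi z tau))%:E.
  rewrite -(mean_transfer (P := P) mVV _ b)// -mean_integral; last exact: bmf_comp.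
  rewrite unlock; apply: eq_integral => w _; congr (_%:E).
  rewrite /= -(edge_prodE piH); apply: eq_bigr => j _; apply: eq_bigr => i _.
  by rewrite !tnth_mktuple.
rewrite lee_fin (mean_edge_prod piH z L_prod unif half).
exact: (mean_sign_prod_SOEI z piH L_prod unif d1).
Qed.
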